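(* Let $E$ be either the Baernstein space $B_p$ for some $1<p<\infty$ or the $p$-convexified Schreier space $S_p$ for some $1\le p<\infty$, and let $T$ and $U$ be strictly singular operators on $E$. Then the composite operator $TU$ is compact.
   Context: $\mathbb{K}$ denotes the scalar field, either $\mathbb{R}$ or $\mathbb{C}$, and $\mathbb{N}=\{1,2,3,\ldots\}$. Sequences are written as functions: $x(n)$ is the $n$-th coordinate of $x\in\mathbb{K}^{\mathbb{N}}$. The unit vector basis $(e_n)_{n\in\mathbb{N}}$ is given by $e_n(m)=1$ if $m=n$ and $e_n(m)=0$ otherwise. A Schreier set is a finite set $F\subset\mathbb{N}$ such that $F=\emptyset$ or $|F|\le\min F$; $\mathcal{S}_1$ denotes the family of all Schreier sets. For non-empty finite sets $F,G\subset\mathbb{N}$, $F<G$ means $\max F<\min G$. $p$-convexified Schreier space $S_p$ ($1\le p<\infty$): for $x\in\mathbb{K}^{\mathbb{N}}$ and $F\in\mathcal{S}_1$ set $\mu_p(x,F)=\bigl(\sum_{n\in F}|x(n)|^p\bigr)^{1/p}$ (equal to $0$ if $F=\emptyset$) and $\|x\|_{S_p}=\sup\{\mu_p(x,F):F\in\mathcal{S}_1\}$. Let $Z_p=\{x\in\mathbb{K}^{\mathbb{N}}:\|x\|_{S_p}<\infty\}$, a Banach space under $\|\cdot\|_{S_p}$; $S_p$ is the closed linear span of $\{e_n:n\in\mathbb{N}\}$ in $Z_p$. Baernstein space $B_p$ ($1<p<\infty$): a Schreier chain is a non-empty finite collection $\mathcal{C}=\{F_1<F_2<\cdots<F_m\}$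 of non-empty Schreier sets. Set $\beta_p(x,\mathcal{C})=\bigl(\sum_{F\in\mathcal{C}}\bigl(\sum_{n\in F}|x(n)|\bigr)^p\bigr)^{1/p}$ and $\|x\|_{B_p}=\sup\{\beta_p(x,\mathcal{C}):\mathcal{C}\text{ a Schreier chain}\}$. Then $B_p=\{x\in\mathbb{K}^{\mathbb{N}}:\|x\|_{B_p}<\infty\}$, a Banach space under $\|\cdot\|_{B_p}$. An operator is a bounded linear map between Banach spaces. An operator $T\colon X\to Y$ is strictly singular if no restriction of $T$ to an infinite-dimensional subspace of $X$ is an isomorphic embedding. An operator on $E$ is an operator from $E$ to $E$. *)

(* Defs.v *)
From HB Require Import structures.
From mathcomp Require Import all_boot all_order all_algebra.
From mathcomp Require Import finmap complex ring.
From mathcomp Require Import all_classical all_reals all_analysis.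

Set Implicit Arguments.
Unset Strict Implicit.
Unset Printing Implicit Defensive.

Import Order.TTheory GRing.Theory Num.Theory.
Import numFieldNormedType.Exports.

Local Open Scope classical_set_scope.
Local Open Scope ring_scope.

Inductive scalar_kind := RealScalars | ComplexScalars.

Definition scalars (R : realType) (k : scalar_kind) : numFieldType :=
  match k with RealScalars => R | ComplexScalars => R[i] end.

(* A norm on a [normedModType K] takes its values in [K]. [modulus] is the
   absolute value as an element of [R], and [of_real] embeds [R] in [K], so that
   [`|a| = of_real (modulus a)], see [normr_modulus]. *)
Definition modulus (R : realType) (k : scalar_kind) : scalars R k -> R :=
  match k return scalars R k -> R with
  | RealScalars => fun a => `|a|
  | ComplexScalars => @Normc.normc R
  end.

Definition of_real (R : realType) (k : scalar_kind) : R -> scalars R k :=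
  match k return R -> scalars R k with
  | RealScalars => id
  | ComplexScalars => @real_complex R
  end.

Section ScalarTheory.
Variables (R : realType) (k : scalar_kind).
Implicit Types (a b : scalars R k) (x y : R).

Lemma normr_modulus a : `|a| = of_real k (modulus a).
Proof. by case: k a => //= -[u v]. Qed.

Lemma of_real_inj : injective (of_real k : R -> scalars R k).
Proof. by case: k => //= x y []. Qed.

Lemma of_realD x y : of_real k (x + y) = of_real k x + of_real k y.
Proof. by case: k => //=; rewrite rmorphD. Qed.

Lemma of_realM x y : of_real k (x * y) = of_real k x * of_real k y.
Proof. by case: k => //=; rewrite rmorphM. Qed.

Lemma of_real0 : of_real k (0 : R) = 0.
Proof. by case: k. Qed.

Lemma ler_of_real x y : (of_real k x <= of_real k y) = (x <= y).
Proof. by case: k => //=; rewrite lecR. Qed.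

Lemma modulus_ge0 a : 0 <= modulus a.
Proof. by rewrite -ler_of_real of_real0 -normr_modulus. Qed.

Lemma modulus0 : modulus (0 : scalars R k) = 0.
Proof. by apply: of_real_inj; rewrite -normr_modulus normr0 of_real0. Qed.

Lemma modulus1 : modulus (1 : scalars R k) = 1.
Proof. by apply: of_real_inj; rewrite -normr_modulus normr1; case: k. Qed.

Lemma modulusM a b : modulus (a * b) = modulus a * modulus b.
Proof. by apply: of_real_inj; rewrite of_realM -!normr_modulus normrM. Qed.

Lemma ler_modulusD a b : modulus (a + b) <= modulus a + modulus b.
Proof. by rewrite -ler_of_real of_realD -!normr_modulus ler_normD. Qed.

Lemma modulus_eq0 a : modulus a = 0 -> a = 0.
Proof.
by move=> a0; apply: normr0_eq0; rewrite normr_modulus a0 of_real0.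
Qed.

End ScalarTheory.

Section Minkowski.
Variables (R : realType) (p : R).
Hypothesis p1 : 1 <= p.

Definition lpnorm (I : Type) (s : seq I) (f : I -> R) : R :=
  (\sum_(i <- s) f i `^ p) `^ p^-1.

Let p_gt0 : 0 < p. Proof. exact: lt_le_trans p1. Qed.
Let p_neq0 : p != 0. Proof. by rewrite gt_eqF. Qed.

Lemma lpnorm_ge0 I (s : seq I) f : 0 <= lpnorm s f.
Proof. exact: powR_ge0. Qed.

Lemma lpnorm_powR I (s : seq I) f : lpnorm s f `^ p = \sum_(i <- s) f i `^ p.
Proof.
by rewrite /lpnorm -powRrM mulVf// powRr1// sumr_ge0// => i _; exact: powR_ge0.
Qed.

Lemma lpnorm_le I (s : seq I) (f g : I -> R) :
  (forall i, 0 <= f i) -> (forall i, f i <= g i) -> lpnorm s f <= lpnorm s g.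
Proof.
move=> f0 fg; apply: ge0_ler_powR; rewrite ?invr_ge0 ?(ltW p_gt0)//.
- by rewrite nnegrE sumr_ge0// => i _; exact: powR_ge0.
- by rewrite nnegrE sumr_ge0// => i _; exact: powR_ge0.
apply: ler_sum => i _; apply: ge0_ler_powR; rewrite ?nnegrE ?(ltW p_gt0)//.
exact: le_trans (fg i).
Qed.

Lemma lpnormZ I (s : seq I) (a : R) (f : I -> R) :
  0 <= a -> (forall i, 0 <= f i) ->
  lpnorm s (fun i => a * f i) = a * lpnorm s f.
Proof.
move=> a0 f0; rewrite /lpnorm.
under eq_bigr do rewrite powRM//.
rewrite -mulr_sumr powRM ?powR_ge0//; last first.
  by rewrite sumr_ge0// => i _; exact: powR_ge0.
by rewrite -powRrM mulfV// powRr1.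
Qed.

Lemma lpnorm_eq0 (I : eqType) (s : seq I) (f : I -> R) :
  lpnorm s f = 0 -> forall i, i \in s -> f i = 0.
Proof.
move=> /powR_eq0_eq0 /eqP.
rewrite psumr_eq0; last by move=> i _; exact: powR_ge0.
by move=> /allP + i si => /(_ i si)/implyP/(_ isT)/eqP/powR_eq0_eq0.
Qed.

Lemma lpnorm_eqr (I : eqType) (s : seq I) (f g : I -> R) :
  {in s, f =1 g} -> lpnorm s f = lpnorm s g.
Proof. by move=> fg; congr (_ `^ _); apply: eq_big_seq => i /fg ->. Qed.

Lemma lpnormD (I : eqType) (s : seq I) (f g : I -> R) :
  (forall i, 0 <= f i) -> (forall i, 0 <= g i) ->
  lpnorm s (fun i => f i + g i) <= lpnorm s f + lpnorm s g.
Proof.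
move=> f0 g0.
have sumE h : (forall i, 0 <= h i) -> lpnorm s h != 0 ->
    \sum_(i <- s) ((lpnorm s h)^-1 * h i) `^ p = 1.
  move=> h0 hn; rewrite -lpnorm_powR lpnormZ ?invr_ge0 ?lpnorm_ge0//.
  by rewrite mulVf// powR1.
move: (sumE f f0) (sumE g g0) => {sumE}.
move: (lpnorm_ge0 s f) (lpnorm_ge0 s g).
move EA : (lpnorm s f) => A; move EB : (lpnorm s g) => B => A0 B0 fE gE.
have [Az|An] := eqVneq A 0.
  rewrite Az add0r -EB le_eqVlt; apply/orP; left; apply/eqP.
  apply: lpnorm_eqr => i si; rewrite Az in EA.
  by rewrite (lpnorm_eq0 EA si) add0r.
have [Bz|Bn] := eqVneq B 0.
  rewrite Bz addr0 -EA le_eqVlt; apply/orP; left; apply/eqP.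
  apply: lpnorm_eqr => i si; rewrite Bz in EB.
  by rewrite (lpnorm_eq0 EB si) addr0.
have Agt0 : 0 < A by rewrite lt_def An.
have Bgt0 : 0 < B by rewrite lt_def Bn.
have ABgt0 : 0 < A + B by exact: addr_gt0.
pose t := A / (A + B).
have t01 : 0 <= t <= 1.
  by rewrite divr_ge0 ?(ltW ABgt0)//= ler_pdivrMr// mul1r lerDl.
pose u i := A^-1 * f i; pose v i := B^-1 * g i.
have u0 i : 0 <= u i by rewrite mulr_ge0// invr_ge0.
have v0 i : 0 <= v i by rewrite mulr_ge0// invr_ge0.
have conv i : (t * u i + (1 - t) * v i) `^ p
              <= t * u i `^ p + (1 - t) * v i `^ p.
  case/andP: t01 => t0 t1.
  by apply: (convex_powR p1 (Itv01 t0 t1)); rewrite inE/= in_itv/= andbT.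
have le1 : lpnorm s (fun i => t * u i + (1 - t) * v i) <= 1.
  apply: (@le_trans _ _ (1 `^ p^-1)); last by rewrite powR1.
  apply: ge0_ler_powR.
  - by rewrite invr_ge0 ltW.
  - by rewrite nnegrE sumr_ge0// => i _; exact: powR_ge0.
  - by rewrite nnegrE.
  apply: (le_trans (ler_sum _ (fun i _ => conv i))).
  by rewrite big_split/= -!mulr_sumr fE// gE// !mulr1 subrKC.
have fgE i : f i + g i = (A + B) * (t * u i + (1 - t) * v i).
  by rewrite /t /u /v; field; rewrite !gt_eqF.
rewrite (@lpnorm_eqr _ s _ (fun i => (A + B) * (t * u i + (1 - t) * v i))); last first.
  by move=> i _; exact: fgE.
rewrite lpnormZ ?(ltW ABgt0)//; last first.
  by move=> i; rewrite addr_ge0// mulr_ge0//; case/andP: t01; rewrite ?subr_ge0.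
by rewrite -[leRHS]mulr1 ler_wpM2l// ltW.
Qed.

End Minkowski.

Section ExtendedNorm.
Variables (R : realType) (k : scalar_kind).
Local Notation K := (scalars R k).

Record extended_norm := ExtendedNorm {
  enorm_fun :> (nat -> K) -> \bar R;
  enormD : forall x y : nat -> K, (enorm_fun (x + y)%R <= enorm_fun x + enorm_fun y)%E;
  enormZ : forall (a : K) (x : nat -> K), (enorm_fun (a *: x)%R = (modulus a)%:E * enorm_fun x)%E;
  enorm_eq0 : forall x, enorm_fun x = 0%E -> x = 0 }.

Section SupNorm.
Variables (I : Type) (D : set I) (s : I -> (nat -> K) -> R).
Hypothesis D0 : D !=set0.
Hypothesis s_ge0 : forall i x, 0 <= s i x.
Hypothesis sD : forall i (x y : nat -> K), s i (x + y) <= s i x + s i y.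
Hypothesis sZ : forall i (a : K) (x : nat -> K), s i (a *: x) = modulus a * s i x.
Hypothesis s_eq0 : forall x, (forall i, D i -> s i x = 0) -> x = 0.

Local Notation N x := (ereal_sup [set (s i x%R)%:E | i in D]).

Lemma ler_supnorm i x : D i -> ((s i x)%:E <= N x)%E.
Proof. by move=> Di; apply: ereal_sup_ubound; exists i. Qed.

Lemma supnormD (x y : nat -> K) : (N (x + y)%R <= N x + N y)%E.
Proof.
apply: ge_ereal_sup => _ [i Di <-].
by rewrite (le_trans _ (leeD (ler_supnorm x Di) (ler_supnorm y Di)))// -EFinD lee_fin.
Qed.

Lemma supnormZ (a : K) (x : nat -> K) : N (a *: x) = ((modulus a)%:E * N x)%E.
Proof.
have le (b : K) (y : nat -> K) : (N (b *: y)%R <= (modulus b)%:E * N y)%E.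
  apply: ge_ereal_sup => _ [i Di <-].
  by rewrite sZ EFinM lee_wpmul2l ?lee_fin ?modulus_ge0// ler_supnorm.
apply/eqP; rewrite eq_le le /=.
have [->|a0] := eqVneq a 0.
  rewrite modulus0 mul0e; have [i Di] := D0.
  by apply: le_trans (ler_supnorm _ Di); rewrite lee_fin.
have am0 : modulus a != 0 by apply: contra_neq a0; exact: modulus_eq0.
have := le a^-1 (a *: x); rewrite scalerA mulVf// scale1r => leN.
have am : modulus a * modulus a^-1 = 1 by rewrite -modulusM mulfV// modulus1.
apply: (le_trans (lee_wpmul2l _ leN)); first by rewrite lee_fin modulus_ge0.
by rewrite muleA -EFinM am mul1e.
Qed.

Lemma supnorm_eq0 x : N x = 0%E -> x = 0.
Proof.
move=> Nx0; apply: s_eq0 => i Di; apply/eqP; rewrite eq_le s_ge0 andbT.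
by rewrite -lee_fin (le_trans (ler_supnorm x Di))// Nx0.
Qed.

End SupNorm.

Section FiniteNormSpace.
Variable N : extended_norm.

Lemma enorm0 : N 0 = 0%E.
Proof. by rewrite -(scale0r (0 : nat -> K)) enormZ modulus0 mul0e. Qed.

Lemma enormN x : N (- x) = N x.
Proof.
rewrite -scaleN1r enormZ; suff -> : modulus (-1 : K) = 1 by rewrite mul1e.
apply: (@of_real_inj _ k).
by rewrite -normr_modulus normrN normr1 -(modulus1 R k) -normr_modulus normr1.
Qed.

Lemma enorm_ge0 x : (0 <= N x)%E.
Proof.
have := enormD N x (- x); rewrite subrr enorm0 enormN.
by case: (N x) => [r| |]//; rewrite -EFinD !lee_fin -mulr2n pmulrn_lge0.
Qed.

Definition finite_enorm : {pred nat -> K} := fun x => (N x < +oo)%E.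

Lemma finite_enorm_submod : submod_closed finite_enorm.
Proof.
split=> [|a x y]; rewrite !unfold_in ?enorm0// => xN yN.
apply: le_lt_trans (enormD _ _ _) _; rewrite enormZ lte_add_pinfty//.
by rewrite lte_mul_pinfty// lee_fin modulus_ge0.
Qed.

HB.instance Definition _ :=
  GRing.isSubmodClosed.Build K (nat -> K) finite_enorm finite_enorm_submod.

Record finite_norm_space := FiniteNormSpace {
  coords :> nat -> K;
  coordsP : coords \in finite_enorm }.

HB.instance Definition _ := [isSub for coords].
HB.instance Definition _ := [Choice of finite_norm_space by <:].
HB.instance Definition _ := [SubChoice_isSubLmodule of finite_norm_space by <:].

Let norm (x : finite_norm_space) : K := of_real k (fine (N x)).

Lemma fine_enorm (x : finite_norm_space) : (fine (N x))%:E = N x.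
Proof. by rewrite fineK// ge0_fin_numE ?enorm_ge0//; exact: (coordsP x). Qed.

Let ler_normD x y : norm (x + y) <= norm x + norm y.
Proof. by rewrite -of_realD ler_of_real -lee_fin EFinD !fine_enorm enormD. Qed.

Let normrZ a x : norm (a *: x) = `|a| * norm x.
Proof.
rewrite normr_modulus -of_realM; congr of_real; apply: EFin_inj.
by rewrite EFinM !fine_enorm enormZ.
Qed.

Let normr0_eq0 x : norm x = 0 -> x = 0.
Proof.
rewrite -(of_real0 R k) => /of_real_inj x0; apply/val_inj/(@enorm_eq0 N).
by rewrite -fine_enorm x0.
Qed.

HB.instance Definition _ :=
  Lmodule_isNormed.Build K finite_norm_space ler_normD normrZ normr0_eq0.

Lemma finite_norm_spaceE (x : finite_norm_space) :
  `|x| = of_real k (fine (N x)).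
Proof. by []. Qed.

End FiniteNormSpace.
End ExtendedNorm.

Section Subspaces.
Variables (K : numFieldType) (V : normedModType K).

Definition linear_span (A : set V) : set V :=
  [set x | exists (n : nat) (c : 'I_n -> K) (v : 'I_n -> V),
     (forall i, A (v i)) /\ x = \sum_(i < n) c i *: v i].

Definition closed_span (A : set V) : {pred V} := [in closure (linear_span A)].

Lemma linear_span_linear A a x y :
  linear_span A x -> linear_span A y -> linear_span A (a *: x + y).
Proof.
move=> [m [c [v [Av ->]]]] [n [d [w [Aw ->]]]].
exists (m + n)%N,
  (fun i => match fintype.split i with inl j => a * c j | inr j => d j end),
  (fun i => match fintype.split i with inl j => v j | inr j => w j end).
split=> [i|]; first by case: fintype.split.
rewrite big_split_ord/= scaler_sumr; congr (_ + _); apply: eq_bigr => i _.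
  by rewrite scalerA (unsplitK (inl i)).
by rewrite (unsplitK (inr i)).
Qed.

Lemma closed_span_submod A : submod_closed (closed_span A).
Proof.
split=> [|a x y]; rewrite /closed_span !inE.
  apply: subset_closure; exists 0%N, (fun=> 0), (fun=> 0).
  by split=> [[]//|]; rewrite big_ord0.
move=> Ax Ay B /nbhs_normP[e /= e0 Be].
have M0 : 0 < `|a| + 1 by rewrite ltr_wpDl.
have d0 : 0 < e / 2 / (`|a| + 1) by rewrite !divr_gt0.
have h0 : 0 < e / 2 by rewrite divr_gt0.
have [u [Au /= xu]] := Ax _ (nbhsx_ballx x _ d0).
have [v [Av /= yv]] := Ay _ (nbhsx_ballx y _ h0).
exists (a *: u + v); split; first exact: linear_span_linear.
apply: Be => /=; move: xu yv; rewrite -ball_normE /= => xu yv.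
rewrite opprD addrACA -scalerBr (le_lt_trans (ler_normD _ _))// normrZ.
rewrite (splitr e) ler_ltD//.
rewrite -[leRHS](divfK (lt0r_neq0 M0)) mulrC ler_pM//; first exact: ltW.
by rewrite lerDl.
Qed.

HB.instance Definition _ A :=
  GRing.isSubmodClosed.Build K V (closed_span A) (closed_span_submod A).

(* The subspace [W] as a normed space in its own right, with the norm of [V]. *)
Record linear_subspace (W : submodClosed V) := LinearSubspace {
  inclusion :> V;
  inclusionP : inclusion \in W }.

Section SubspaceNorm.
Variable W : submodClosed V.

HB.instance Definition _ := [isSub for @inclusion W].
HB.instance Definition _ := [Choice of linear_subspace W by <:].
HB.instance Definition _ := [SubChoice_isSubLmodule of linear_subspace W by <:].

Let norm (x : linear_subspace W) : K := `|inclusion x|.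

Let ler_normD x y : norm (x + y) <= norm x + norm y.
Proof. exact: ler_normD. Qed.

Let normrZ a x : norm (a *: x) = `|a| * norm x.
Proof. exact: normrZ. Qed.

Let normr0_eq0 x : norm x = 0 -> x = 0.
Proof. by move=> /normr0_eq0 x0; exact/val_inj. Qed.

HB.instance Definition _ :=
  Lmodule_isNormed.Build K (linear_subspace W) ler_normD normrZ normr0_eq0.

Lemma norm_inclusion (x : linear_subspace W) : `|x| = `|inclusion x|.
Proof. by []. Qed.

End SubspaceNorm.

Definition finite_dimensional :=
  exists (n : nat) (v : 'I_n -> V), linear_span (range v) = setT.

End Subspaces.

Arguments finite_dimensional {K} V.

Section Operators.
Variables (K : numFieldType) (V W : normedModType K).

Definition bounded_operator (T : V -> W) :=
  exists M : K, forall x, `|T x| <= M * `|x|.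

Definition isomorphic_embedding (T : V -> W) :=
  continuous T /\
  exists S : W -> V, cancel T S /\ {within range T, continuous S}.

Definition compact_operator (T : V -> W) :=
  precompact (T @` [set x | `|x| <= 1]).

End Operators.

Definition strictly_singular (K : numFieldType) (V W : normedModType K)
    (T : V -> W) :=
  forall X : submodClosed V, ~ finite_dimensional (linear_subspace X) ->
    ~ isomorphic_embedding (T \o @inclusion K V X).

(* The index [n : nat] stands for the positive integer [n + 1]: the entry [x n]
   is the coordinate x(n+1), so that |F| <= min F reads [#|` F| <= n.+1] for all
   [n] in [F]. *)
Definition schreier_set (F : {fset nat}) : bool :=
  all (fun n => #|` F| <= n.+1)%N F.

Definition schreier_chain (C : seq {fset nat}) : bool :=
  [&& C != [::], all (fun F => (F != fset0) && schreier_set F) C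
    & pairwise (fun F G : {fset nat} => allrel ltn F G) C].

Section Spaces.
Variables (R : realType) (k : scalar_kind).
Local Notation K := (scalars R k).
Implicit Types (x y : nat -> K) (p : R).

Definition unit_vector (n : nat) : nat -> K := fun m => (m == n)%:R.

Definition schreier_mu p x (F : {fset nat}) : R :=
  (\sum_(n <- F) modulus (x n) `^ p) `^ p^-1.

Definition schreier_norm p x : \bar R :=
  ereal_sup [set (schreier_mu p x F)%:E | F in [set F | schreier_set F]].

Definition baernstein_beta p x (C : seq {fset nat}) : R :=
  (\sum_(F <- C) (\sum_(n <- F) modulus (x n)) `^ p) `^ p^-1.

Definition baernstein_norm p x : \bar R :=
  ereal_sup [set (baernstein_beta p x C)%:E | C in [set C | schreier_chain C]].

Lemma schreier_set1 n : schreier_set [fset n]%fset.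
Proof. by apply/allP => m; rewrite inE => /eqP ->; rewrite cardfs1. Qed.

Lemma schreier_muE p x F :
  schreier_mu p x F = lpnorm p F (fun n => modulus (x n)).
Proof. by []. Qed.

Lemma baernstein_betaE p x C :
  baernstein_beta p x C =
  lpnorm p C (fun F : {fset nat} => \sum_(n <- F) modulus (x n)).
Proof. by []. Qed.

Section Schreier.
Variable p : R.
Hypothesis p1 : 1 <= p.

Lemma schreier_sets0 : [set F | schreier_set F] !=set0.
Proof. by exists [fset 0%N]%fset; exact: schreier_set1. Qed.

Lemma schreier_mu_ge0 F x : 0 <= schreier_mu p x F.
Proof. exact: powR_ge0. Qed.

Lemma schreier_muD F x y :
  schreier_mu p (x + y) F <= schreier_mu p x F + schreier_mu p y F.
Proof.
rewrite !schreier_muE; apply: le_trans (lpnormD p1 _ _ _) => [|i|i]; last 2 first.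
- exact: modulus_ge0.
- exact: modulus_ge0.
by apply: lpnorm_le => // i; rewrite ?modulus_ge0 ?ler_modulusD.
Qed.

Lemma schreier_muZ F (a : K) x : schreier_mu p (a *: x) F = modulus a * schreier_mu p x F.
Proof.
transitivity (lpnorm p F (fun n => modulus a * modulus (x n))).
  by apply: lpnorm_eqr => i _; exact: modulusM.
by apply: (lpnormZ p1) => [|i]; exact: modulus_ge0.
Qed.

Lemma schreier_mu_eq0 x : (forall F, schreier_set F -> schreier_mu p x F = 0) -> x = 0.
Proof.
move=> x0; apply/funext => n; apply: modulus_eq0.
have := x0 _ (schreier_set1 n); rewrite schreier_muE => /lpnorm_eq0.
by apply; rewrite inE.
Qed.

Definition schreier_enorm : extended_norm R k :=
  @ExtendedNorm R k (schreier_norm p)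
    (supnormD _ schreier_muD)
    (supnormZ schreier_sets0 schreier_mu_ge0 schreier_muZ)
    (supnorm_eq0 schreier_mu_ge0 schreier_mu_eq0).

Lemma schreier_mu_unit n F : schreier_mu p (unit_vector n) F <= 1.
Proof.
rewrite (_ : 1 = 1 `^ p^-1); last by rewrite powR1.
have p0 : 0 < p by exact: lt_le_trans p1.
apply: ge0_ler_powR; rewrite ?nnegrE ?invr_ge0 ?ler01 ?(ltW p0)//.
  by rewrite sumr_ge0// => i _; exact: powR_ge0.
have E m : modulus (unit_vector n m) `^ p = (m == n)%:R.
  rewrite /unit_vector; case: (m == n); rewrite ?modulus1 ?powR1//.
  by rewrite modulus0 powR0// gt_eqF.
under eq_bigr do rewrite E.
rewrite -natr_sum -[leRHS]/(1%:R) ler_nat.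
rewrite (eq_bigr (fun m => if m == n then 1%N else 0%N)); last first.
  by move=> m _; case: (m == n).
by rewrite -big_mkcond sum1_count count_uniq_mem ?fset_uniq// leq_b1.
Qed.

Lemma unit_vector_finite n : unit_vector n \in finite_enorm schreier_enorm.
Proof.
rewrite unfold_in; apply: (@le_lt_trans _ _ 1%:E); last exact: ltry.
by apply: ge_ereal_sup => _ [F _ <-]; rewrite lee_fin schreier_mu_unit.
Qed.

(* The Banach space Z_p of all sequences of finite S_p-norm *)
Definition schreier_Z : normedModType K := finite_norm_space schreier_enorm.

Definition schreier_basis (n : nat) : schreier_Z :=
  FiniteNormSpace (unit_vector_finite n).

Definition schreier_space : normedModType K :=
  linear_subspace (closed_span (range schreier_basis)).

End Schreier.

Section Baernstein.
Variable p : R.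
Hypothesis p_gt1 : 1 < p.

Let p1 : 1 <= p. Proof. exact: ltW. Qed.

Lemma schreier_chain1 n : schreier_chain [:: [fset n]%fset].
Proof.
rewrite /schreier_chain/= schreier_set1 !andbT.
by apply/fset0Pn; exists n; rewrite inE.
Qed.

Lemma schreier_chains0 : [set C | schreier_chain C] !=set0.
Proof. by exists [:: [fset 0%N]%fset]; exact: schreier_chain1. Qed.

Let sum_ge0 (F : {fset nat}) x : 0 <= \sum_(n <- F) modulus (x n).
Proof. by rewrite sumr_ge0// => n _; exact: modulus_ge0. Qed.

Lemma baernstein_beta_ge0 C x : 0 <= baernstein_beta p x C.
Proof. exact: powR_ge0. Qed.

Lemma baernstein_betaD C x y :
  baernstein_beta p (x + y) C <= baernstein_beta p x C + baernstein_beta p y C.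
Proof.
pose f (z : nat -> K) (F : {fset nat}) := \sum_(n <- F) modulus (z n).
apply: (@le_trans _ _ (lpnorm p C (fun F => f x F + f y F))); last first.
  by apply: (lpnormD p1) => F; exact: sum_ge0.
apply: (lpnorm_le p1) => F; first exact: sum_ge0.
by rewrite -big_split/=; apply: ler_sum => n _; exact: ler_modulusD.
Qed.

Lemma baernstein_betaZ C (a : K) x : baernstein_beta p (a *: x) C = modulus a * baernstein_beta p x C.
Proof.
transitivity
    (lpnorm p C (fun F : {fset nat} => modulus a * \sum_(n <- F) modulus (x n))).
  apply: lpnorm_eqr => F _; rewrite mulr_sumr.
  by apply: eq_bigr => n _; exact: modulusM.
by apply: (lpnormZ p1) => // ; exact: modulus_ge0.
Qed.

Lemma baernstein_beta_eq0 x : (forall C, schreier_chain C -> baernstein_beta p x C = 0) -> x = 0.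
Proof.
move=> x0; apply/funext => n; apply: modulus_eq0.
have := x0 _ (schreier_chain1 n); rewrite baernstein_betaE => /lpnorm_eq0.
by move=> /(_ [fset n]%fset); rewrite big_seq_fset1; apply; rewrite inE.
Qed.

Definition baernstein_enorm : extended_norm R k :=
  @ExtendedNorm R k (baernstein_norm p)
    (supnormD _ baernstein_betaD)
    (supnormZ schreier_chains0 baernstein_beta_ge0 baernstein_betaZ)
    (supnorm_eq0 baernstein_beta_ge0 baernstein_beta_eq0).

Definition baernstein_space : normedModType K :=
  finite_norm_space baernstein_enorm.

End Baernstein.
End Spaces.

(* Main.v *)
From HB Require Import structures.
Require Import Defs.
From mathcomp Require Import all_boot all_order all_algebra.
From mathcomp Require Import finmap complex ring lra.
From mathcomp Require Import all_classical all_reals all_analysis.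

Set Implicit Arguments.
Unset Strict Implicit.
Unset Printing Implicit Defensive.

Import Order.TTheory GRing.Theory Num.Theory.
Import numFieldNormedType.Exports.

Local Open Scope classical_set_scope.
Local Open Scope ring_scope.

(** Why the composition is compact.

    In both spaces the norm is a supremum over chains of successive Schreier sets:
    [chain_norm q p] takes the [l_q]-norm on each set of the chain and the
    [l_p]-norm of the results. The norm of [B_p] is the supremum over all chains
    with [q = 1], that of [S_p] the supremum over the chains of one set with
    [q = p]. Both are treated at once, as a [chain_space]; the boolean [full]
    says whether long chains are allowed.

    Consider a sequence of blocks, that is, consecutive intervals of indices. If
    a Schreier set [F] meets several blocks, split it into its part in the first
    of them and the rest ([chain_norm_split]). The first part is bounded by the
    norm of a single block. The rest has few elements compared with their
    positions, because the cardinality of [F] is bounded by its least element,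
    which lies in the first block. This has two consequences for bounded vectors
    [d j] supported in the blocks.

    - If [k j] lies in the block [j], the rest of [F] can be traded for the
      Schreier set of the [k j] whose blocks it meets; so the [d j] are dominated
      by the unit vectors at the [k j] ([chain_norm_large_coordinates]).

    - If the coordinates of [d j] decrease to 0 fast, the rest of [F] contributes
      next to nothing; so the [d j] are dominated by the unit vectors of [l_p], or
      of [c_0] for [S_p] ([chain_norm_small_blocks]). Conversely, blocks whose
      norms are bounded below dominate these unit vectors
      ([block_lower_estimate]).

    A gliding hump turns this into two facts on a strictly singular operator [S]
    and a bounded vector [d] such that [d] and [S d] have small coordinates in a
    long initial segment: all coordinates of [S d] are small
    ([small_image_coordinates]), and if all coordinates of [d] are small, then so
    is the norm of [S d] ([small_image_norm]). For otherwise one finds vectors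
    [d j] that are dominated by their images, and [S] is an isomorphic embedding
    of their span ([domination_not_strictly_singular]). Applied to [U] and then to
    [T], these facts show that [T (U d)] is small when [d], [U d] and [T (U d)]
    have small coordinates in a long initial segment ([small_composite]).

    Finally, along an ultrafilter on the unit ball, the coordinates of [x], [U x]
    and [T (U x)] converge. Hence [small_composite] applies to the difference of
    two vectors of a suitable member of the ultrafilter, and [T (U x)] converges
    in norm. Taking differences makes the coordinates of all three vectors small
    at the same time. *)

(** * Finite [l_p]-norms *)

Lemma ler_sum_seq (R : numDomainType) (I : eqType) (s : seq I) (f g : I -> R) :
  {in s, forall i, f i <= g i} -> \sum_(i <- s) f i <= \sum_(i <- s) g i.
Proof. by move=> fg; rewrite big_seq [leRHS]big_seq; exact: ler_sum. Qed.

Section LpNorm.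
Variables (R : realType) (p : R).
Hypothesis p1 : 1 <= p.

Let p_gt0 : 0 < p. Proof. exact: lt_le_trans p1. Qed.
Let p_neq0 : p != 0. Proof. by rewrite gt_eqF. Qed.

Lemma ler_powRp (a b : R) : 0 <= a -> a <= b -> a `^ p <= b `^ p.
Proof.
move=> a0 ab; apply: ge0_ler_powR; rewrite ?nnegrE ?(ltW p_gt0)//.
exact: le_trans ab.
Qed.

Lemma lpnorm_le_powR I (s : seq I) (f : I -> R) (b : R) :
  0 <= b -> \sum_(i <- s) f i `^ p <= b `^ p -> lpnorm p s f <= b.
Proof.
move=> b0 le; rewrite /lpnorm -[leRHS](powRr1 b0) -(mulfV p_neq0) powRrM.
apply: ge0_ler_powR; rewrite ?nnegrE ?powR_ge0 ?invr_ge0 ?(ltW p_gt0)//.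
by rewrite sumr_ge0// => i _; exact: powR_ge0.
Qed.

Lemma lpnorm_ge_powR I (s : seq I) (f : I -> R) (b : R) :
  0 <= b -> b `^ p <= \sum_(i <- s) f i `^ p -> b <= lpnorm p s f.
Proof.
move=> b0 le; rewrite /lpnorm -[leLHS](powRr1 b0) -(mulfV p_neq0) powRrM.
apply: ge0_ler_powR; rewrite ?nnegrE ?powR_ge0 ?invr_ge0 ?(ltW p_gt0)//.
by rewrite sumr_ge0// => i _; exact: powR_ge0.
Qed.

Lemma lpnorm_nil I (f : I -> R) : lpnorm p [::] f = 0.
Proof. by rewrite /lpnorm big_nil powR0// invr_eq0. Qed.

Lemma lpnorm1 I (i : I) (f : I -> R) : 0 <= f i -> lpnorm p [:: i] f = f i.
Proof. by move=> f0; rewrite /lpnorm big_seq1 -powRrM mulfV// powRr1. Qed.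

Lemma lpnorm_le_in (I : eqType) (s : seq I) (f g : I -> R) :
  {in s, forall i, 0 <= f i <= g i} -> lpnorm p s f <= lpnorm p s g.
Proof.
move=> fg; apply: lpnorm_le_powR; first exact: powR_ge0.
rewrite lpnorm_powR//; apply: ler_sum_seq => i si.
by have /andP[f0 fgi] := fg i si; exact: ler_powRp.
Qed.

Lemma lpnorm_ge_term (I : eqType) (s : seq I) (f : I -> R) i :
  i \in s -> 0 <= f i -> f i <= lpnorm p s f.
Proof.
move=> si f0; apply: lpnorm_ge_powR => //.
by rewrite (big_rem i)//= lerDl sumr_ge0// => j _; exact: powR_ge0.
Qed.

Lemma lpnorm_le_sum (I : eqType) (s : seq I) (f : I -> R) :
  (forall i, 0 <= f i) -> lpnorm p s f <= \sum_(i <- s) f i.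
Proof.
move=> f0; set S := \sum_(i <- s) f i.
have S0 : 0 <= S by exact: sumr_ge0.
apply: lpnorm_le_powR => //.
rewrite -(mulr_powRB1 S0 p_gt0) {1}/S mulr_suml.
apply: ler_sum_seq => i si; rewrite -(mulr_powRB1 (f0 i) p_gt0).
rewrite ler_wpM2l//; apply: ge0_ler_powR; rewrite ?nnegrE ?subr_ge0//.
by rewrite /S (big_rem i)//= lerDl sumr_ge0.
Qed.

(** At each point the sum over all pieces majorizes the piece that dominates [g]
    there, so the [p]-th powers can be summed piece by piece; the pieces may
    overlap. *)
Lemma lpnorm_pieces (T : eqType) (s : seq T) (J : seq nat) (g : T -> R)
    (h : nat -> T -> R) (alpha : nat -> R) (M : R) :
  0 <= M -> (forall t, 0 <= g t) -> (forall j t, 0 <= h j t) ->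
  (forall j, 0 <= alpha j) ->
  {in s, forall t, g t = 0 \/ exists2 j, j \in J & g t <= alpha j * h j t} ->
  {in J, forall j, lpnorm p s (h j) <= M} ->
  lpnorm p s g <= M * lpnorm p J alpha.
Proof.
move=> M0 g0 h0 a0 gh hM; apply: lpnorm_le_powR.
  by rewrite mulr_ge0 ?lpnorm_ge0.
rewrite powRM ?lpnorm_ge0// lpnorm_powR//.
apply: (@le_trans _ _ (\sum_(t <- s) \sum_(j <- J) (alpha j * h j t) `^ p)).
  apply: ler_sum_seq => t st; have [->|[j jJ le]] := gh t st.
    by rewrite powR0// sumr_ge0// => j _; exact: powR_ge0.
  rewrite (big_rem j)//=; apply: (le_trans (ler_powRp _ le)) => //.
  by rewrite lerDl sumr_ge0// => i _; exact: powR_ge0.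
rewrite exchange_big/= mulr_sumr; apply: ler_sum_seq => j jJ.
under eq_bigr do rewrite powRM//.
rewrite -mulr_sumr -lpnorm_powR// mulrC ler_wpM2r ?powR_ge0//.
by apply: ler_powRp; rewrite ?lpnorm_ge0// hM.
Qed.

End LpNorm.

Lemma lpnorm_filter (R : realType) (p : R) (I : Type) (s : seq I) (P : pred I)
    (f : I -> R) : 1 <= p ->
  lpnorm p [seq i <- s | P i] f = lpnorm p s (fun i => if P i then f i else 0).
Proof.
move=> p1; rewrite /lpnorm big_filter big_mkcond; congr (_ `^ _).
apply: eq_bigr => i _; case: ifP => // _.
by rewrite powR0// gt_eqF// (lt_le_trans ltr01).
Qed.

Lemma lpnorm_fset_filter (R : realType) (p : R) (F : {fset nat}) (P : pred nat)
    (f : nat -> R) : 1 <= p ->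
  lpnorm p [fset m in F | P m]%fset f = lpnorm p F (fun m => if P m then f m else 0).
Proof.
move=> p1; rewrite -(lpnorm_filter _ _ _ p1) /lpnorm; congr (_ `^ _); apply: perm_big.
apply: uniq_perm; rewrite ?fset_uniq ?filter_uniq ?fset_uniq// => m.
by rewrite !inE/= mem_filter andbC.
Qed.

Lemma lpnorm_map (R : realType) (p : R) (I J : Type) (k : I -> J) (s : seq I)
    (f : J -> R) : lpnorm p [seq k i | i <- s] f = lpnorm p s (f \o k).
Proof. by rewrite /lpnorm big_map. Qed.

Lemma lpnorm_imfset (R : realType) (p : R) (k : nat -> nat) (F : {fset nat})
    (f : nat -> R) : injective k ->
  lpnorm p [fset k j | j in F]%fset f = lpnorm p F (f \o k).
Proof.
move=> kI; rewrite /lpnorm; congr (_ `^ _).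
rewrite -[RHS](big_map k xpredT (fun i => f i `^ p)); apply: perm_big.
by rewrite (perm_trans (enum_imfset _ _))// => ? ? _ _; exact: kI.
Qed.

Lemma lpnorm_p1 (R : realType) (I : Type) (s : seq I) (f : I -> R) :
  (forall i, 0 <= f i) -> lpnorm 1 s f = \sum_(i <- s) f i.
Proof.
move=> f0; rewrite /lpnorm invr1 powRr1.
  by apply: eq_bigr => i _; rewrite powRr1.
by apply: sumr_ge0 => i _; exact: powR_ge0.
Qed.

#[local] Opaque lpnorm.

(** * Norms defined by chains of Schreier sets *)

Section ChainNorm.
Variables (R : realType) (q p : R).
Hypotheses (q1 : 1 <= q) (p1 : 1 <= p).
Implicit Types (f g : nat -> R) (C : seq {fset nat}).

(** With [q = 1] this is [baernstein_beta p]; on a chain with one set it is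
    [schreier_mu q]. *)
Definition chain_norm f C : R :=
  lpnorm p C (fun F : {fset nat} => lpnorm q F f).

Lemma chain_norm_ge0 f C : 0 <= chain_norm f C.
Proof. exact: lpnorm_ge0. Qed.

Lemma chain_norm_powR f C :
  chain_norm f C `^ p = \sum_(F <- C) lpnorm q (F : {fset nat}) f `^ p.
Proof. exact: lpnorm_powR. Qed.

Lemma chain_norm1 f F : chain_norm f [:: F] = lpnorm q F f.
Proof. by rewrite /chain_norm lpnorm1//; exact: lpnorm_ge0. Qed.

Lemma chain_norm_nil f : chain_norm f [::] = 0.
Proof. exact: lpnorm_nil. Qed.

Lemma chain_norm_drop_empty f C :
  chain_norm f [seq F <- C | F != fset0] = chain_norm f C.
Proof.
rewrite /chain_norm (lpnorm_filter _ _ _ p1); apply: lpnorm_eqr => F _.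
by case: eqVneq => [->|//]; rewrite lpnorm_nil.
Qed.

Lemma chain_norm_le f g C :
  (forall m, 0 <= f m <= g m) -> chain_norm f C <= chain_norm g C.
Proof.
move=> fg; apply: lpnorm_le_in => // F _; rewrite lpnorm_ge0/=.
by apply: lpnorm_le_in => // m _.
Qed.

Lemma chain_normD f g C : (forall m, 0 <= f m) -> (forall m, 0 <= g m) ->
  chain_norm (fun m => f m + g m) C <= chain_norm f C + chain_norm g C.
Proof.
move=> f0 g0; apply: le_trans (lpnormD p1 _ _ _); last 2 first.
- by move=> F; exact: lpnorm_ge0.
- by move=> F; exact: lpnorm_ge0.
apply: lpnorm_le_in => // F _; rewrite lpnorm_ge0/=.
exact: lpnormD.
Qed.

Lemma chain_normZ (a : R) f C : 0 <= a -> (forall m, 0 <= f m) ->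
  chain_norm (fun m => a * f m) C = a * chain_norm f C.
Proof.
move=> a0 f0.
transitivity (lpnorm p C (fun F : {fset nat} => a * lpnorm q F f)).
  by apply: lpnorm_eqr => F _; exact: lpnormZ.
by apply: (lpnormZ p1) => // F; exact: lpnorm_ge0.
Qed.

Lemma chain_norm0 C : chain_norm (fun=> 0) C = 0.
Proof.
transitivity (chain_norm (fun m => 0 * (fun=> 0) m) C).
  by apply: (f_equal (chain_norm^~ C)); apply/funext => m; rewrite mul0r.
by rewrite chain_normZ// mul0r.
Qed.

Lemma chain_norm_sum n (a : nat -> R) (g : nat -> nat -> R) C :
  (forall j, 0 <= a j) -> (forall j m, 0 <= g j m) ->
  chain_norm (fun m => \sum_(j < n) a j * g j m) C <=
  \sum_(j < n) a j * chain_norm (g j) C.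
Proof.
move=> a0 g0; elim: n => [|n IH].
  rewrite big_ord0 (_ : (fun _ => _) = fun=> 0) ?chain_norm0//.
  by apply/funext => m; rewrite big_ord0.
rewrite big_ord_recr/=.
rewrite (_ : (fun _ => _) = fun m =>
    \sum_(j < n) a j * g j m + a n * g n m); last first.
  by apply/funext => m; rewrite big_ord_recr.
apply: (le_trans (chain_normD _ _ _)).
- by move=> m; rewrite sumr_ge0// => j _; rewrite mulr_ge0.
- by move=> m; rewrite mulr_ge0.
by rewrite (chain_normZ C (a0 n) (g0 n)) lerD2r.
Qed.

End ChainNorm.

Lemma chain_norm_q1 (R : realType) (p : R) (f : nat -> R) (C : seq {fset nat}) :
  (forall m, 0 <= f m) ->
  chain_norm 1 p f C = lpnorm p C (fun F : {fset nat} => \sum_(m <- F) f m).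
Proof. by move=> f0; apply: lpnorm_eqr => F _; exact: lpnorm_p1. Qed.

Definition successive (C : seq {fset nat}) : bool :=
  pairwise (fun F G : {fset nat} => allrel ltn F G) C.

(** Successive sets are disjoint. *)
Lemma sum_successive_le (R : realType) (C : seq {fset nat}) n (f : nat -> R) :
  successive C -> (forall m, 0 <= f m) -> (forall m, (n <= m)%N -> f m = 0) ->
  \sum_(F <- C) \sum_(m <- (F : {fset nat})) f m <= \sum_(m < n) f m.
Proof.
move=> sC f0 fn.
have -> : \sum_(F <- C) \sum_(m <- (F : {fset nat})) f m =
    \sum_(m <- flatten [seq (F : seq nat) | F : {fset nat} <- C]) f m.
  by rewrite big_flatten/= big_map.
set s := flatten _.
have us : uniq s.
  rewrite /s {s}; elim: C sC => //= F C IH /andP[FC sC].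
  rewrite cat_uniq fset_uniq IH// andbT/=; apply/hasPn => m.
  move=> /flattenP[_ /mapP[G GC ->] mG]; apply/negP => mF.
  have := allP FC G GC => /allrelP/(_ m m mF mG).
  by rewrite /= ltnn.
rewrite (bigID (fun m => m < n)%N)/= [X in _ + X]big1 ?addr0; last first.
  by move=> m; rewrite -leqNgt => /fn.
rewrite -(big_mkord xpredT f) -big_filter.
rewrite [leRHS](bigID (fun m => m \in s))/= -[leLHS]addr0 lerD//; last first.
  by rewrite sumr_ge0.
rewrite -[leRHS]big_filter le_eqVlt; apply/orP; left; apply/eqP.
apply: perm_big; apply: uniq_perm; rewrite ?filter_uniq ?iota_uniq//.
by move=> m; rewrite !mem_filter mem_index_iota/= andbC.
Qed.

Lemma chain_norm_le_sum (R : realType) (q p : R) (q1 : 1 <= q) (p1 : 1 <= p)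
    (C : seq {fset nat}) n (f : nat -> R) :
  successive C -> (forall m, 0 <= f m) -> (forall m, (n <= m)%N -> f m = 0) ->
  chain_norm q p f C <= \sum_(m < n) f m.
Proof.
move=> sC f0 fn; apply: le_trans (sum_successive_le sC f0 fn).
apply: (le_trans (lpnorm_le_sum p1 _ _)) => [F|]; first exact: lpnorm_ge0.
by apply: ler_sum => F _; exact: lpnorm_le_sum.
Qed.

Lemma schreier_set_sub (F G : {fset nat}) :
  (G `<=` F)%fset -> schreier_set F -> schreier_set G.
Proof.
move=> GF /allP sF; apply/allP => m mG.
exact: leq_trans (fsubset_leq_card GF) (sF m (fsubsetP GF _ mG)).
Qed.

(** Empty sets are allowed, because cutting the sets of a chain down can empty
    some of them. *)
Definition admissible (full : bool) (C : seq {fset nat}) : bool :=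
  [&& all schreier_set C, successive C & full || (size C <= 1)%N].

Lemma chain_norm_point (R : realType) (q p : R) (full : bool) (f : nat -> R) m :
  1 <= q -> 1 <= p -> (forall n, 0 <= f n) ->
  exists2 C, admissible full C & f m <= chain_norm q p f C.
Proof.
move=> q1 p1 f0; exists [:: [fset m]%fset].
  by rewrite /admissible/= schreier_set1 orbT.
by rewrite chain_norm1//; exact: lpnorm_ge_term (fset11 m) (f0 m).
Qed.

Lemma fset_min_exists : exists mn : {fset nat} -> nat,
  forall (F : {fset nat}) m, m \in F -> mn F \in F /\ (mn F <= m)%N.
Proof.
suff /choice[mn mnP] : forall F : {fset nat}, exists l : nat,
    forall m, m \in F -> l \in F /\ (l <= m)%N by exists mn.
move=> F; have [->|/fset0Pn[m0 m0F]] := eqVneq F fset0; first by exists 0%N.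
have exF : exists m, m \in F by exists m0.
by have := ex_minnP exF; move=> [l lF lmin]; exists l => m mF; split=> //; exact: lmin.
Qed.

(** * Weighted sums of blocks *)

(** The block of the index [m] is [b m]. Only moduli matter: [xi] and [eta] are
    the moduli of two sequences of vectors, the [j]-th of which lives in block [j],
    glued together, and [alpha j] is the modulus of the coefficient of the [j]-th
    vector. *)
Section Blocks.
Variables (R : realType) (q p : R).
Hypotheses (q1 : 1 <= q) (p1 : 1 <= p).
Variables (full : bool) (b : nat -> nat) (xi eta alpha : nat -> R) (M delta S : R).
Hypothesis b_mono : {homo b : m n / (m <= n)%N}.
Hypotheses (xi_ge0 : forall m, 0 <= xi m) (eta_ge0 : forall m, 0 <= eta m).
Hypothesis alpha_ge0 : forall j, 0 <= alpha j.
Hypotheses (delta_gt0 : 0 < delta) (M_ge0 : 0 <= M).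
Hypothesis xi_le : forall j C, admissible full C ->
  chain_norm q p (fun m => if b m == j then xi m else 0) C <= M.
Hypothesis eta_le : forall C, admissible full C ->
  chain_norm q p (fun m => alpha (b m) * eta m) C <= S.

Let b_lt m n : (b m < b n)%N -> (m < n)%N.
Proof. by apply: contraTT; rewrite -!leqNgt => /b_mono. Qed.

Section LowerEstimate.
Hypothesis eta_ge : forall j, exists2 C, admissible full C &
  delta <= chain_norm q p (fun m => if b m == j then eta m else 0) C.

(** Chains that norm the single blocks can be cut down to their blocks and
    concatenated; this gives a lower [p]-estimate when all chains are allowed,
    and the trivial maximum estimate when a chain has only one set. *)
Lemma block_lower_estimate (J : seq nat) :
  sorted ltn J -> full || (size J <= 1)%N -> delta * lpnorm p J alpha <= S.
Proof.
move=> sJ fJ.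
have /choice[D DP] : forall j, exists C, admissible full C /\
  delta <= chain_norm q p (fun m => if b m == j then eta m else 0) C.
  by move=> j; have [C] := eta_ge j; exists C.
pose cut j (F : {fset nat}) := [fset m in F | b m == j]%fset.
pose CJ := flatten [seq [seq cut j F | F <- D j] | j <- J].
have aCJ : admissible full CJ.
  apply/and3P; split.
  - apply/allP => G /flattenP[_ /mapP[j jJ ->] /mapP[F FD ->]].
    have [/and3P[/allP/(_ F FD) sF _ _] _] := DP j.
    by apply: schreier_set_sub sF; apply/fsubsetP => m; rewrite !inE => /andP[].
  - rewrite /CJ {CJ fJ}; elim: J sJ => //= j J IH sJ.
    rewrite /successive pairwise_cat -/(successive _) -/(successive _).
    rewrite IH ?(path_sorted sJ)// andbT; apply/andP; split.
      apply/allrelP => F' G' /mapP[F FD ->].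
      move=> /flattenP[_ /mapP[i iJ ->] /mapP[G GD ->]].
      apply/allrelP => m n; rewrite !inE => /andP[_ /eqP bm] /andP[_ /eqP bn].
      apply: b_lt; rewrite bm bn.
      by have /allP := order_path_min ltn_trans sJ; exact.
    have [/and3P[_ sD _] _] := DP j.
    rewrite /successive pairwise_map; apply: sub_pairwise sD.
    move=> F G /allrelP FG; apply/allrelP => m n.
    by rewrite !inE => /andP[mF _] /andP[nG _]; exact: FG.
  - case: full fJ DP => //= fJ DP.
    rewrite /CJ; case: J sJ fJ {CJ} => [|j [|]]//= _ _.
    by rewrite cats0 size_map; have [/and3P[]] := DP j.
apply: le_trans (eta_le aCJ).
apply: lpnorm_ge_powR => //.
  by rewrite mulr_ge0 ?lpnorm_ge0// ltW.
rewrite (powRM _ (ltW delta_gt0) (lpnorm_ge0 p J alpha)).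
rewrite (lpnorm_powR p1 J alpha).
rewrite big_flatten/= big_map mulr_sumr; apply: ler_sum => j _.
rewrite big_map -(powRM _ (ltW delta_gt0) (alpha_ge0 j)) mulrC.
have [_ dD] := DP j.
apply: (@le_trans _ _ ((alpha j * chain_norm q p
    (fun m => if b m == j then eta m else 0) (D j)) `^ p)).
  by apply: (ler_powRp p1); [exact: mulr_ge0 (ltW delta_gt0)|exact: ler_wpM2l].
rewrite -chain_normZ//; last by move=> m; case: ifP.
rewrite (chain_norm_powR _ p1); apply: ler_sum => F _.
apply: (ler_powRp p1); first exact: lpnorm_ge0.
rewrite (lpnorm_fset_filter _ _ _ q1); apply: lpnorm_le_in => // m _.
by case: ifP => [/eqP ->|_]; rewrite ?mulr0 ?lexx ?mulr_ge0.
Qed.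

Variable mn : {fset nat} -> nat.
Hypothesis mnP : forall (F : {fset nat}) m, m \in F -> mn F \in F /\ (mn F <= m)%N.

Definition later_blocks (F : {fset nat}) : {fset nat} :=
  [fset j in [seq b m | m <- F & b m != b (mn F)]]%fset.

Lemma later_blocksP F j : reflect
  (exists m, [/\ m \in F, (b (mn F) < b m)%N & j = b m]) (j \in later_blocks F).
Proof.
rewrite !inE; apply: (iffP mapP) => [[m]|[m [mF bm ->]]].
  rewrite mem_filter => /andP[bm mF] ->; exists m; split=> //.
  by rewrite ltn_neqAle eq_sym bm b_mono//; have [] := mnP mF.
by exists m => //; rewrite mem_filter mF gtn_eqF.
Qed.

Lemma card_later_blocks F : (#|` later_blocks F| <= #|` F|)%N.
Proof.
rewrite card_fseq (leq_trans (size_undup _))// size_map size_filter.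
exact: count_size.
Qed.

(** The last block that a set of the chain meets can be the first block, but
    none of the later blocks, that the next set meets. *)
Lemma successive_later_blocks (C : seq {fset nat}) :
  successive C -> successive [seq later_blocks F | F <- C].
Proof.
rewrite /successive pairwise_map; apply: sub_pairwise => F G /allrelP FG.
apply/allrelP => i j /later_blocksP[m [mF _ ->]] /later_blocksP[n [nG bn ->]].
apply: leq_ltn_trans bn; apply: b_mono; apply: ltnW; apply: FG => //.
by have [] := mnP nG.
Qed.

Let later (f : nat -> R) (F : {fset nat}) m :=
  if b m == b (mn F) then 0 else f m.

Let later_ge0 f F m : (forall n, 0 <= f n) -> 0 <= later f F m.
Proof. by move=> f0; rewrite /later; case: ifP. Qed.

(** The pieces of the sets in their first blocks are bounded by [M] block by
    block, and the lower estimate for [eta] bounds the weights of these blocks. *)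
Lemma chain_norm_split (C : seq {fset nat}) : admissible full C ->
  chain_norm q p (fun m => alpha (b m) * xi m) C <= M / delta * S +
  lpnorm p C (fun F => lpnorm q F (later (fun m => alpha (b m) * xi m) F)).
Proof.
move=> aC; pose g m := alpha (b m) * xi m.
have g0 m : 0 <= g m by rewrite mulr_ge0.
pose first F m := if b m == b (mn F) then g m else 0.
have first0 F m : 0 <= first F m by rewrite /first; case: ifP.
apply: (@le_trans _ _ (lpnorm p C
    (fun F : {fset nat} => lpnorm q F (first F) + lpnorm q F (later g F)))).
  apply: (lpnorm_le_in p1) => F _; rewrite lpnorm_ge0/=.
  apply: le_trans (lpnormD q1 F (first0 F) (fun m => later_ge0 F m g0)).
  apply: (lpnorm_le_in q1) => m _; rewrite g0/= /first /later.
  by case: ifP => _; rewrite ?addr0 ?add0r.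
have nfirst0 (F : {fset nat}) := lpnorm_ge0 q F (first F).
have nlater0 (F : {fset nat}) := lpnorm_ge0 q F (later g F).
apply: (le_trans (lpnormD p1 C nfirst0 nlater0)); rewrite lerD2r.
(* The blocks in which some set of the chain starts: there are at most as many as
   sets, which matters when only chains of one set are allowed. *)
pose J := sort leq (undup [seq b (mn F) | F <- C]).
have sJ : sorted ltn J.
  by rewrite ltn_sorted_uniq_leq sort_uniq undup_uniq sort_sorted.
have fJ : full || (size J <= 1)%N.
  case/and3P: aC => _ _; case: full => //= sC.
  by rewrite size_sort (leq_trans (size_undup _))// size_map.
have le : lpnorm p C (fun F : {fset nat} => lpnorm q F (first F)) <=
    M * lpnorm p J alpha.
  apply: (@lpnorm_pieces _ _ p1 _ _ _ _ (fun j (F : {fset nat}) =>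
    lpnorm q F (fun m => if b m == j then xi m else 0))).
  - exact: M_ge0.
  - by move=> F; exact: lpnorm_ge0.
  - by move=> j F; exact: lpnorm_ge0.
  - exact: alpha_ge0.
  - move=> F FC; right; exists (b (mn F)).
      by rewrite mem_sort mem_undup map_f.
    have h0 m : 0 <= if b m == b (mn F) then xi m else 0 by case: ifP.
    rewrite -(lpnormZ q1 F (alpha_ge0 (b (mn F))) h0).
    apply: (lpnorm_le_in q1) => m _; rewrite first0/= /first.
    by case: ifP => [/eqP <-|_]; rewrite ?mulr0.
  - by move=> j _; exact: xi_le.
apply: (le_trans le); rewrite -mulrA ler_wpM2l// mulrC ler_pdivlMr// mulrC.
exact: block_lower_estimate.
Qed.


(** Let the coordinates of each block be small compared with the positions of the
    earlier blocks. A Schreier set that starts in an earlier block has too few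
    elements to see them, so that only its first block matters. *)
Lemma chain_norm_small_blocks (eps : nat -> R) n (C : seq {fset nat}) :
  (forall j, 0 <= eps j) ->
  (forall m m', (b m' < b m)%N -> m'.+1%:R * xi m <= eps (b m)) ->
  (forall j, (n <= j)%N -> alpha j = 0) ->
  admissible full C ->
  chain_norm q p (fun m => alpha (b m) * xi m) C <=
  M / delta * S + \sum_(j < n) alpha j * eps j.
Proof.
move=> eps0 xi_small alphan aC; apply: le_trans (chain_norm_split aC) _.
rewrite lerD2l; pose g m := alpha (b m) * xi m; rewrite -/g.
have g0 m : 0 <= g m by rewrite mulr_ge0.
have /and3P[sC succC _] := aC.
have w0 j : 0 <= alpha j * eps j by rewrite mulr_ge0.
apply: (@le_trans _ _
    (\sum_(F <- C) \sum_(j <- later_blocks F) alpha j * eps j)); last first.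
  rewrite -(big_map later_blocks xpredT
    (fun G : {fset nat} => \sum_(j <- G) alpha j * eps j)).
  apply: (sum_successive_le (successive_later_blocks succC) w0).
  by move=> j /alphan ->; rewrite mul0r.
apply: (le_trans (lpnorm_le_sum p1 _ (fun F : {fset nat} => lpnorm_ge0 q F _))).
apply: ler_sum_seq => F FC.
apply: (le_trans (lpnorm_le_sum q1 _ (fun m => later_ge0 F m g0))).
pose h j m := if b m == j then xi m else 0.
have h0 j m : 0 <= h j m by rewrite /h; case: ifP.
apply: (@le_trans _ _ (\sum_(m <- F) \sum_(j <- later_blocks F) alpha j * h j m)).
  apply: ler_sum_seq => m mF; rewrite /later.
  case: eqVneq => [_|bm]; first by apply: sumr_ge0 => j _; exact: mulr_ge0.
  have mJ : b m \in later_blocks F.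
    apply/later_blocksP; exists m; split=> //.
    by rewrite ltn_neqAle eq_sym bm b_mono//; have [] := mnP mF.
  rewrite (big_rem _ mJ)/= {1}/h eqxx lerDl.
  by apply: sumr_ge0 => j _; exact: mulr_ge0.
rewrite exchange_big/=; apply: ler_sum_seq => j /later_blocksP[m [mF bm ->]].
rewrite -mulr_sumr; apply: ler_wpM2l; first exact: alpha_ge0.
have [mnF _] := mnP mF.
have sF : (#|` F| <= (mn F).+1)%N by exact: (allP (allP sC F FC)).
have c0 : 0 < (mn F).+1%:R :> R by rewrite ltr0n.
apply: (@le_trans _ _ (\sum_(i <- F) eps (b m) / (mn F).+1%:R)).
  apply: ler_sum => i _; rewrite /h; case: eqP => [bi|_].
    by rewrite ler_pdivlMr// mulrC -bi; apply: xi_small; rewrite bi.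
  by rewrite divr_ge0// ltW.
rewrite big_const_seq count_predT iter_addr_0 -[leLHS]mulr_natr mulrAC ler_pdivrMr//.
by rewrite ler_wpM2l// ler_nat.
Qed.

End LowerEstimate.

(** Let each block contain a coordinate [k j] at which [eta] is at least [delta].
    If a Schreier set meets the blocks [j] of a set [J] besides its first one,
    then [k j], for [j] in [J], form a Schreier set, because they are at least as
    few and lie further to the right. *)
Lemma chain_norm_large_coordinates (k : nat -> nat) (C : seq {fset nat}) :
  (forall j, b (k j) = j) -> (forall j, delta <= eta (k j)) ->
  admissible full C ->
  chain_norm q p (fun m => alpha (b m) * xi m) C <= M / delta * S *+ 2.
Proof.
move=> bk etak aC.
have d0 : 0 <= delta by exact: ltW.
have c0 : 0 <= M / delta by rewrite divr_ge0.
have eta_ge j : exists2 C, admissible full C &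
    delta <= chain_norm q p (fun m => if b m == j then eta m else 0) C.
  pose f m := if b m == j then eta m else 0.
  have f0 m : 0 <= f m by rewrite /f; case: ifP.
  have [D aD le] := chain_norm_point full (k j) q1 p1 f0.
  exists D => //; apply: le_trans le; apply: (le_trans (etak j)).
  by rewrite /f bk eqxx.
have [mn mnP] := fset_min_exists.
apply: (le_trans (chain_norm_split eta_ge mn aC)).
rewrite mulr2n lerD2l; pose g m := alpha (b m) * xi m; rewrite -/g.
pose J := later_blocks mn.
pose G F := [fset k j | j in J F]%fset.
have kI : injective k by exact: can_inj bk.
have /and3P[sC succC fC] := aC.
have aG : admissible full (map G C).
  apply/and3P; split; last by rewrite size_map.
  - apply/allP => _ /mapP[F FC ->]; apply/allP => _ /imfsetP[j/= jJ ->].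
    have /(later_blocksP mnP)[m [mF bm jE]] := jJ.
    have [mnF _] := mnP _ _ mF.
    apply: (leq_trans (leq_imfset_card _ _ _)).
    apply: (leq_trans (card_later_blocks mn F)).
    apply: (leq_trans (allP (allP sC F FC) _ mnF)).
    by apply/ltnW; rewrite ltnS; apply: b_lt; rewrite bk jE.
  - have := successive_later_blocks mnP succC.
    rewrite /successive !pairwise_map; apply: sub_pairwise => F F'.
    move=> /allrelP FF'; apply/allrelP => m m'.
    move=> /imfsetP[j/= jJ ->] /imfsetP[j'/= jJ' ->].
    by apply: b_lt; rewrite !bk; exact: FF'.
have := ler_wpM2l c0 (eta_le aG); apply: le_trans.
rewrite /chain_norm lpnorm_map.
rewrite -(lpnormZ p1 C c0 (fun F => lpnorm_ge0 q (G F) _)).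
apply: (lpnorm_le_in p1) => F FC; rewrite lpnorm_ge0/=.
pose h j m := if b m == j then xi m else 0.
have h0 j m : 0 <= h j m by rewrite /h; case: ifP.
have JG : delta * lpnorm q (J F) alpha <=
    lpnorm q (G F) (fun m => alpha (b m) * eta m).
  rewrite (lpnorm_imfset _ _ _ kI) -(lpnormZ q1 _ d0 alpha_ge0).
  apply: (lpnorm_le_in q1) => j _ /=; rewrite bk mulrC.
  by rewrite mulr_ge0//= ler_wpM2l.
apply: (@le_trans _ _ (M * lpnorm q (J F) alpha)); last first.
  by rewrite -mulrA; apply: (ler_wpM2l M_ge0); rewrite mulrC ler_pdivlMr// mulrC.
apply: (@lpnorm_pieces _ _ q1 _ _ _ _ h).
- exact: M_ge0.
- by move=> m; case: ifP => // _; rewrite mulr_ge0.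
- exact: h0.
- exact: alpha_ge0.
- move=> m mF; case: eqVneq => [_|bm]; [by left|right].
  exists (b m); last by rewrite /h eqxx.
  apply/(later_blocksP mnP); exists m; split=> //.
  by rewrite ltn_neqAle eq_sym bm b_mono//; have [] := mnP _ _ mF.
- move=> j _; rewrite -(chain_norm1 q p1); apply: xi_le.
  by rewrite /admissible/= (allP sC F FC) orbT.
Qed.

End Blocks.

(** * Strictly singular operators and domination *)

Section StrictlySingular.
Variables (K : numFieldType) (V W : normedModType K).

Definition sequence_span (d : nat -> V) : {pred V} := [in linear_span (range d)].

Lemma sequence_span_submod d : submod_closed (sequence_span d).
Proof.
split=> [|a x y]; rewrite /sequence_span !inE.
  by exists 0%N, (fun=> 0), (fun=> 0); split=> [[]//|]; rewrite big_ord0.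
exact: linear_span_linear.
Qed.

HB.instance Definition _ d :=
  GRing.isSubmodClosed.Build K V (sequence_span d) (sequence_span_submod d).

(** Collecting the coefficients of repeated vectors. *)
Lemma linear_span_family (I : finType) (v : I -> V) x :
  linear_span (range v) x -> exists a : I -> K, x = \sum_i a i *: v i.
Proof.
move=> [n [c [w [/= vw ->]]]].
have /choice[f fP] : forall i, exists j, v j = w i.
  by move=> i; have [j _ <-] := vw i; exists j.
exists (fun j => \sum_(i | f i == j) c i).
transitivity (\sum_i \sum_j (if f i == j then c i *: v j else 0)).
  apply: eq_bigr => i _; rewrite -big_mkcond (big_pred1 (f i)); first by rewrite fP.
  by move=> j; rewrite eq_sym.
rewrite exchange_big/=; apply: eq_bigr => j _.
by rewrite -big_mkcond/= scaler_suml.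
Qed.

Lemma sequence_spanP d x : x \in sequence_span d ->
  exists n (a : nat -> K), x = \sum_(j < n) a j *: d j.
Proof.
rewrite inE => -[m [c [w [/= dw ->]]]].
have /choice[f fP] : forall i, exists j, d j = w i.
  by move=> i; have [j _ <-] := dw i; exists j.
pose n := (\max_i f i).+1.
have fn i : (f i < n)%N by rewrite ltnS (leq_bigmax i).
have [a aE] : exists a : 'I_n -> K,
    \sum_(i < m) c i *: w i = \sum_(j < n) a j *: d j.
  apply: (@linear_span_family _ (fun j : 'I_n => d j)).
  exists m, c, w; split=> // i.
  by exists (Ordinal (fn i)) => //=; rewrite fP.
exists n, (fun j => if insub j is Some i then a i else 0).
by rewrite aE; apply: eq_bigr => j _; rewrite valK.
Qed.

(** If [m] vectors spanned the space, the [m + 1] rows of coefficients of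
    [d 0, ..., d m] would have a nontrivial left kernel. *)
Lemma not_finite_dimensional (d : nat -> V) :
  (forall n (a : nat -> K), \sum_(j < n) a j *: d j = 0 ->
     forall j, (j < n)%N -> a j = 0) ->
  ~ finite_dimensional V.
Proof.
move=> dfree [m [v vT]].
have /choice[A AE] : forall j, exists a : 'I_m -> K, d j = \sum_i a i *: v i.
  by move=> j; apply: linear_span_family; rewrite vT.
pose B : 'M[K]_(m.+1, m) := \matrix_(j, i) A j i.
have : kermx B != 0.
  by rewrite -mxrank_eq0 mxrank_ker -lt0n subn_gt0 ltnS rank_leq_col.
case/rowV0Pn => u /sub_kermxP uB; case/rV0Pn => j uj.
pose a i := if insub i is Some i then u ord0 i else 0.
have aE (i : 'I_m.+1) : a i = u ord0 i by rewrite /a valK.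
have /dfree/(_ j (ltn_ord j)) : \sum_(i < m.+1) a i *: d i = 0.
  under eq_bigr do rewrite AE scaler_sumr.
  rewrite exchange_big big1//= => i _.
  under eq_bigr do rewrite scalerA.
  rewrite -scaler_suml (_ : \sum_i0 _ = 0) ?scale0r//.
  transitivity ((u *m B) ord0 i); last by rewrite uB mxE.
  by rewrite mxE; apply: eq_bigr => l _; rewrite aE mxE.
by rewrite aE => uj0; rewrite uj0 eqxx in uj.
Qed.

Lemma bounded_operator_continuous (f : V -> W) :
  (forall x y, f (x - y) = f x - f y) -> bounded_operator f -> continuous f.
Proof.
move=> fB [M fM] x; apply/cvgrPdist_lt => e e0.
have M0 : 0 < `|M| + 1 by rewrite ltr_wpDl.
near=> y; rewrite -fB.
have h : `|x - y| < e / (`|M| + 1).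
  by near: y; apply: cvgr_dist_lt; [exact: cvg_id|exact: divr_gt0].
have Mh : M * `|x - y| <= `|M| * `|x - y|.
  rewrite -[X in _ <= _ * X]normr_id -normrM; apply: real_ler_norm.
  have : 0 <= M * `|x - y| by exact: le_trans (fM _).
  exact: ger0_real.
apply: (le_lt_trans (fM _)); apply: (le_lt_trans Mh).
apply: (@le_lt_trans _ _ ((`|M| + 1) * `|x - y|)).
  by rewrite ler_wpM2r// lerDl.
by rewrite mulrC -ltr_pdivlMr.
Unshelve. all: by end_near. Qed.

End StrictlySingular.

(** The inequality for the [d j] extends to their linear span, on which it says
    that [S] has a bounded inverse. *)
Lemma domination_not_strictly_singular (K : numFieldType) (V W : normedModType K)
    (S : {linear V -> W}) (d : nat -> V) (c : K) :
  bounded_operator S ->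
  (forall n (a : nat -> K), 
     `|\sum_(j < n) a j *: d j| <= c * `|\sum_(j < n) a j *: S (d j)|) ->
  (forall n (a : nat -> K), \sum_(j < n) a j *: d j = 0 ->
     forall j, (j < n)%N -> a j = 0) ->
  ~ strictly_singular S.
Proof.
move=> [M SM] Sc dfree sS.
pose X : submodClosed V := sequence_span d.
pose i := @inclusion K V X.
have Sge (x : linear_subspace X) : `|i x| <= c * `|S (i x)|.
  have [n [a xE]] := sequence_spanP (inclusionP x); rewrite /i xE.
  by rewrite linear_sum; under [in leRHS]eq_bigr do rewrite linearZ.
have iB x y : i (x - y) = i x - i y by [].
have dX j : d j \in X.
  rewrite inE; exists 1%N, (fun=> 1), (fun=> d j); split; first by move=> _; exists j.
  by rewrite big_ord1 scale1r.
apply: (sS X).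
  apply: (@not_finite_dimensional K (linear_subspace X)
    (fun j => LinearSubspace (dX j))) => n a a0; apply: dfree.
  have iD x y : i (x + y) = i x + i y by [].
  by have := congr1 i a0; rewrite (big_morph i iD (erefl : i 0 = 0)).
split.
  apply: bounded_operator_continuous; last by exists M => x; exact: SM.
  by move=> x y /=; rewrite -linearB.
have inj : injective (S \o i).
  move=> x y /= xy; apply/val_inj/eqP; rewrite -subr_eq0 -normr_le0.
  have := Sge (x - y); rewrite iB linearB xy subrr normr0 mulr0.
  exact.
have /choice[G GS] : forall y, exists x, range (S \o i) y -> S (i x) = y.
  move=> y; have [[x _ <-]|ny] := pselect (range (S \o i) y).
    by exists x.
  by exists 0 => /ny.
have can : cancel (S \o i) G by move=> x; apply: inj; rewrite /= GS//; exists x.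
exists G; split=> //.
have canE x : G (S (i x)) = x by exact: can.
apply/subspace_continuousP => _ [x _ <-].
have -> : from_subspace (range (S \o i)) G ((S \o i) x) = x by exact: canE.
apply/cvgrPdist_lt => e e0.
have c0 : 0 < `|c| + 1 by rewrite ltr_wpDl.
rewrite near_withinE; near=> y => -[x' _ yE].
have h : `|S (i x) - y| < e / (`|c| + 1).
  by near: y; apply: cvgr_dist_lt; [exact: cvg_id|exact: divr_gt0].
rewrite (_ : from_subspace _ G y = x'); last by rewrite -yE; exact: canE.
change (`|i (x - x')| < e).
have ch : c * `|S (i (x - x'))| <= `|c| * `|S (i (x - x'))|.
  rewrite -[X in _ <= _ * X]normr_id -normrM; apply: real_ler_norm.
  by apply: ger0_real; apply: le_trans (Sge _).
apply: (le_lt_trans (Sge _)); apply: (le_lt_trans ch).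
apply: (@le_lt_trans _ _ ((`|c| + 1) * `|S (i (x - x'))|)).
  by rewrite ler_wpM2r// lerDl.
by rewrite mulrC -ltr_pdivlMr// iB linearB; move: h; rewrite -yE.
Unshelve. all: by end_near. Qed.

#[local] Opaque chain_norm.

(** * Spaces normed by chains *)

Section ScalarSums.
Variables (R : realType) (k : scalar_kind).
Local Notation K := (scalars R k).

Lemma ltr_of_real (x y : R) : (of_real k x < of_real k y) = (x < y).
Proof. by rewrite !lt_def ler_of_real (inj_eq (@of_real_inj R k)). Qed.

Lemma of_real1 : of_real k (1 : R) = 1.
Proof. by case: k. Qed.

Lemma modulusN (a : K) : modulus (- a) = modulus a.
Proof. by apply: (@of_real_inj _ k); rewrite -!normr_modulus normrN. Qed.

Lemma ler_modulus_sum n (f : nat -> K) :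
  modulus (\sum_(j < n) f j) <= \sum_(j < n) modulus (f j).
Proof.
elim: n => [|n IH]; first by rewrite !big_ord0 modulus0.
rewrite !big_ord_recr/=; apply: le_trans (ler_modulusD _ _) _.
by rewrite lerD2r.
Qed.

Lemma absorb_error (x y t : R) : 0 <= x -> 0 <= t -> t *+ 6 <= y ->
  x * (y + t *+ 2) *+ 2 + t + t *+ 2 <= (x * 3 + 1) * y.
Proof.
move=> x0 t0 ty.
have h : x * (y + t *+ 2) <= x * (y * (3 / 2)) by apply: ler_wpM2l => //; lra.
have -> : (x * 3 + 1) * y = x * (y * (3 / 2)) *+ 2 + y by field.
by move: (x * (y + t *+ 2)) (x * (y * (3 / 2))) h => u v h; lra.
Qed.

End ScalarSums.

(** The properties of [B_p] and [S_p] on which the proof rests. Smallness of the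
    tails and completeness are stated through the coordinates, because vectors
    enter the estimates only through the moduli of their coordinates. *)
Record chain_space (R : realType) (k : scalar_kind) (q p : R) (full : bool)
    (E : normedModType (scalars R k)) := ChainSpace {
  coord : E -> nat -> scalars R k;
  rnorm : E -> R;
  coordD : forall x y m, coord (x + y) m = coord x m + coord y m;
  coordZ : forall a x m, coord (a *: x) m = a * coord x m;
  normE : forall x, `|x| = of_real k (rnorm x);
  chain_norm_le_rnorm : forall x C, admissible full C ->
    chain_norm q p (fun m => modulus (coord x m)) C <= rnorm x;
  rnorm_le : forall x r, (forall C, admissible full C ->
    chain_norm q p (fun m => modulus (coord x m)) C <= r) -> rnorm x <= r;
  small_tail : forall x e, 0 < e -> exists s, forall C, admissible full C ->
    chain_norm q p (fun m => if (m < s)%N then 0 else modulus (coord x m)) C <= e;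
  coord_complete : forall z : nat -> scalars R k,
    (forall e, 0 < e -> exists y, forall C, admissible full C ->
      chain_norm q p (fun m => modulus (z m - coord y m)) C <= e) ->
    exists x, coord x = z }.

Section ChainSpaceTheory.
Variables (R : realType) (k : scalar_kind) (q p : R) (full : bool).
Hypotheses (q1 : 1 <= q) (p1 : 1 <= p).
Variables (E : normedModType (scalars R k)) (cE : chain_space q p full E).
Local Notation K := (scalars R k).
Local Notation c := (coord cE).
Local Notation nrm := (rnorm cE).
Implicit Types (x y : E).

Lemma rnorm_ge0 x : 0 <= nrm x.
Proof. by rewrite -(ler_of_real k) of_real0 -normE. Qed.

Lemma ler_rnormD x y : nrm (x + y) <= nrm x + nrm y.
Proof. by rewrite -(ler_of_real k) of_realD -!normE ler_normD. Qed.

Lemma rnormN x : nrm (- x) = nrm x.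
Proof. by apply: (@of_real_inj _ k); rewrite -!normE normrN. Qed.

Lemma rnorm0 : nrm 0 = 0.
Proof. by apply: (@of_real_inj _ k); rewrite -normE normr0 of_real0. Qed.

Lemma coordN x m : c (- x) m = - c x m.
Proof. by rewrite -scaleN1r coordZ mulN1r. Qed.

Lemma coordB x y m : c (x - y) m = c x m - c y m.
Proof. by rewrite coordD coordN. Qed.

Lemma rnorm_le1 x : `|x| <= 1 <-> nrm x <= 1.
Proof. by rewrite (normE cE) -(of_real1 R k) ler_of_real. Qed.

Lemma nbhs_rnormP x (N : set E) :
  nbhs x N <-> exists2 e, 0 < e & forall y, nrm (y - x) < e -> N y.
Proof.
split=> [/nbhs_normP[e /= e0 eN]|[e e0 eN]].
  have eE : e = of_real k (modulus e) by rewrite -normr_modulus gtr0_norm.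
  exists (modulus e) => [|y yx].
    by rewrite -(ltr_of_real k) of_real0 -eE.
  by apply: eN; rewrite /= distrC (normE cE) eE ltr_of_real.
apply/nbhs_normP; exists (of_real k e) => /=.
  by rewrite -(of_real0 R k) ltr_of_real.
by move=> y /=; rewrite distrC (normE cE) ltr_of_real => /eN.
Qed.

Lemma coord_sum n (a : nat -> K) (d : nat -> E) m :
  c (\sum_(j < n) a j *: d j) m = \sum_(j < n) a j * c (d j) m.
Proof.
rewrite (big_morph (fun x => c x m) (id1 := 0) (op1 := +%R)).
- by apply: eq_bigr => j _; rewrite coordZ.
- by move=> x y; rewrite coordD.
- by rewrite -(scale0r (0 : E)) coordZ mul0r.
Qed.

Lemma coord_le_rnorm x m : modulus (c x m) <= nrm x.
Proof.
have [C aC] := chain_norm_point full m q1 p1 (fun n => modulus_ge0 (c x n)).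
by move=> /le_trans; apply; exact: chain_norm_le_rnorm.
Qed.

Definition real_bounded (S : E -> E) (M : R) := forall x, nrm (S x) <= M * nrm x.

Lemma bounded_operator_real (S : E -> E) :
  bounded_operator S -> exists2 M, 0 <= M & real_bounded S M.
Proof.
move=> [M SM]; exists (modulus M) => [|x]; first exact: modulus_ge0.
rewrite -(ler_of_real k) of_realM -!normE -normr_modulus.
apply: (le_trans (SM x)); rewrite -[X in _ <= _ * X]normr_id -normrM.
by apply: real_ler_norm; apply: ger0_real; apply: le_trans (SM x).
Qed.

Section Blocks.
Variables (s : nat -> nat) (b : nat -> nat).
Hypothesis sb : forall m, (s (b m) <= m < s (b m).+1)%N.
Hypothesis s_mono : {homo s : m n / (m <= n)%N}.
Variables (eps : nat -> R).

Definition almost_in_block x j := forall C, admissible full C ->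
  chain_norm q p (fun m => if (m < s j)%N then modulus (c x m) else 0) C <= eps j /\
  chain_norm q p (fun m => if (m < s j.+1)%N then 0 else modulus (c x m)) C <= eps j.

Definition off_block x j m := if b m == j then 0 else modulus (c x m).

Lemma block_mono : {homo b : m n / (m <= n)%N}.
Proof.
move=> m n mn; rewrite leqNgt; apply/negP => nm.
have /andP[sm _] := sb m; have /andP[_ sn] := sb n.
have := leq_trans sn (leq_trans (s_mono nm) sm).
by rewrite ltnNge mn.
Qed.

Lemma off_block_ge0 x j m : 0 <= off_block x j m.
Proof. by rewrite /off_block; case: ifP => // _; exact: modulus_ge0. Qed.

Lemma chain_norm_off_block x j C : almost_in_block x j -> admissible full C ->
  chain_norm q p (off_block x j) C <= eps j *+ 2.
Proof.
move=> xj aC; have [le1 le2] := xj C aC; rewrite mulr2n.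
apply: le_trans (lerD le1 le2).
have f0 m : 0 <= if (m < s j)%N then modulus (c x m) else 0.
  by case: ifP => // _; exact: modulus_ge0.
have g0 m : 0 <= if (m < s j.+1)%N then 0 else modulus (c x m).
  by case: ifP => // _; exact: modulus_ge0.
apply: le_trans (chain_normD q1 p1 C f0 g0).
apply: (chain_norm_le q1 p1) => m; rewrite off_block_ge0/= /off_block.
case: eqVneq => [_|bm]; first by rewrite addr_ge0.
have /andP[sm ms] := sb m.
case: ltnP => [_|jm]; first by rewrite lerDl.
case: ltnP => [mj|_]; last by rewrite add0r.
case/eqP: bm; apply/eqP; rewrite eqn_leq.
apply/andP; split; rewrite leqNgt; apply/negP => h.
  by have := leq_trans mj (leq_trans (s_mono h) sm); rewrite ltnn.
by have := leq_trans ms (leq_trans (s_mono h) jm); rewrite ltnn.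
Qed.

Variables (d : nat -> E) (S : {linear E -> E}) (M delta : R).
Hypothesis S_bounded : bounded_operator S.
Hypotheses (eps0 : forall j, 0 <= eps j) (delta_gt0 : 0 < delta) (M0 : 0 <= M).
Hypothesis eps_small : forall n, \sum_(j < n) eps j <= delta / 8.
Hypothesis d_in : forall j, almost_in_block (d j) j.
Hypothesis Sd_in : forall j, almost_in_block (S (d j)) j.

Let xi m := modulus (c (d (b m)) m).
Let eta m := modulus (c (S (d (b m))) m).

Let alpha n (a : nat -> K) j := if (j < n)%N then modulus (a j) else 0.

Let alpha_ge0 n a j : 0 <= alpha n a j.
Proof. by rewrite /alpha; case: ifP => // _; exact: modulus_ge0. Qed.

(** Up to the parts of the vectors outside their blocks, the moduli of a linear
    combination are those of the vectors glued together. *)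
Lemma block_pointwise (z : nat -> E) n (a : nat -> K) m :
  let v := modulus (c (\sum_(j < n) a j *: z j) m) in
  let w := alpha n a (b m) * modulus (c (z (b m)) m) in
  let e := \sum_(j < n) alpha n a j * off_block (z j) j m in
  v <= w + e /\ w <= v + e.
Proof.
move=> v w e.
pose t j := a j * c (z j) m.
pose u : K := if (b m < n)%N then t (b m) else 0.
have wE : w = modulus u.
  by rewrite /w /u /alpha; case: ifP => _; rewrite ?modulusM// mul0r modulus0.
have vE : c (\sum_(j < n) a j *: z j) m =
    u + \sum_(j < n) if b m == j then 0 else t j.
  rewrite coord_sum -/(t _) (bigID (fun j : 'I_n => j == b m :> nat))/=.
  rewrite (big_ord1_eq _ t) -/u big_mkcond/=; congr (_ + _).
  by apply: eq_bigr => j _; rewrite eq_sym; case: eqVneq.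
have eE : modulus (\sum_(j < n) if b m == j then 0 else t j) <= e.
  apply: le_trans (ler_modulus_sum _ (fun j => if b m == j then 0 else t j)) _.
  apply: ler_sum => j _; rewrite /alpha ltn_ord /off_block.
  by case: ifP => _; rewrite ?modulus0 ?mulr0// modulusM.
split; first by rewrite /v vE wE (le_trans (ler_modulusD _ _))// lerD2l.
rewrite wE -[u in modulus u](addrK (\sum_(j < n) if b m == j then 0 else t j)).
rewrite -vE (le_trans (ler_modulusD _ _))// modulusN lerD2l.
exact: eE.
Qed.

Lemma chain_norm_error (z : nat -> E) n (a : nat -> K) C :
  (forall j, almost_in_block (z j) j) -> admissible full C ->
  chain_norm q p (fun m => \sum_(j < n) alpha n a j * off_block (z j) j m) C <=
  (\sum_(j < n) alpha n a j * eps j) *+ 2.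
Proof.
move=> zb aC; apply: le_trans (chain_norm_sum q1 p1 n C (alpha_ge0 n a)
  (fun j => off_block_ge0 (z j) j)) _.
rewrite -sumrMnl; apply: ler_sum => j _; rewrite -mulrnAr.
by apply: ler_wpM2l; [exact: alpha_ge0|exact: chain_norm_off_block].
Qed.

(** Replacing the vectors by their restrictions to the blocks costs at most
    [2 * \sum_j alpha j * eps j] in norm. The lower estimate bounds each
    [alpha j] by a multiple of the norm of the image, so this error is a small
    fraction of that norm. *)
Lemma block_domination :
  (forall j, exists2 C, admissible full C &
    delta <= chain_norm q p (fun m => if b m == j then eta m else 0) C) ->
  (forall alpha n r C, (forall j, 0 <= alpha j) ->
    (forall j, (n <= j)%N -> alpha j = 0) ->
    (forall C, admissible full C ->
      chain_norm q p (fun m => alpha (b m) * eta m) C <= r) ->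
    admissible full C ->
    chain_norm q p (fun m => alpha (b m) * xi m) C <=
      M / delta * r *+ 2 + \sum_(j < n) alpha j * eps j) ->
  ~ strictly_singular S.
Proof.
move=> eta_ge dom.
have eta0 m : 0 <= eta m by exact: modulus_ge0.
have xi0 m : 0 <= xi m by exact: modulus_ge0.
have err0 (z : nat -> E) n a m : 0 <= \sum_(j < n) alpha n a j * off_block (z j) j m.
  by apply: sumr_ge0 => j _; apply: mulr_ge0; [exact: alpha_ge0|exact: off_block_ge0].
pose N n a := nrm (\sum_(j < n) a j *: S (d j)).
pose tau n a := \sum_(j < n) alpha n a j * eps j.
have tau0 n a : 0 <= tau n a.
  by apply: sumr_ge0 => j _; apply: mulr_ge0; [exact: alpha_ge0|exact: eps0].
have upper n a C : admissible full C ->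
    chain_norm q p (fun m => alpha n a (b m) * eta m) C <= N n a + tau n a *+ 2.
  move=> aC; apply: le_trans (lerD (chain_norm_le_rnorm cE _ aC)
    (chain_norm_error n a Sd_in aC)).
  pose v := \sum_(j < n) a j *: S (d j).
  apply: le_trans (chain_normD q1 p1 C (fun m => modulus_ge0 (c v m))
    (err0 (fun j => S (d j)) n a)).
  apply: (chain_norm_le q1 p1) => m; apply/andP; split.
    by apply: mulr_ge0; [exact: alpha_ge0|exact: eta0].
  by have [] := block_pointwise (fun j => S (d j)) n a m.
have coef n a j : delta * alpha n a j <= N n a + tau n a *+ 2.
  have := @block_lower_estimate _ _ _ q1 p1 full b eta (alpha n a) delta _
    block_mono eta0 (alpha_ge0 n a) delta_gt0 (upper n a) eta_ge [:: j] isT (orbT _).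
  by rewrite lpnorm1.
have tauN n a : tau n a *+ 6 <= N n a.
  have : delta * tau n a <= (N n a + tau n a *+ 2) * (delta / 8).
    apply: (@le_trans _ _ (\sum_(j < n) (N n a + tau n a *+ 2) * eps j)).
      rewrite mulr_sumr; apply: ler_sum => j _; rewrite mulrA.
      by apply: ler_wpM2r; [exact: eps0|exact: coef].
    rewrite -mulr_sumr; apply: ler_wpM2l; last exact: eps_small.
    by apply: addr_ge0; [exact: rnorm_ge0|rewrite mulrn_wge0].
  rewrite mulrCA ler_pM2l// ler_pdivlMr//.
  by move: (N n a) (tau n a) => x y; lra.
apply: (@domination_not_strictly_singular _ _ _ S d
    (of_real k (M / delta * 3 + 1))) => //.
  move=> n a; rewrite !(normE cE) -of_realM ler_of_real -/(N n a).
  apply: rnorm_le => C aC.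
  have le1 := @dom (alpha n a) n _ C (alpha_ge0 n a) _ (upper n a) aC.
  have le2 := chain_norm_error n a d_in aC.
  apply: (@le_trans _ _
    (M / delta * (N n a + tau n a *+ 2) *+ 2 + tau n a + tau n a *+ 2)).
    apply: (le_trans _ (lerD (le1 _) le2)); last first.
      by move=> j nj; rewrite /alpha ltnNge nj.
    have axi0 m : 0 <= alpha n a (b m) * xi m.
      by apply: mulr_ge0; [exact: alpha_ge0|exact: xi0].
    apply: le_trans (chain_normD q1 p1 C axi0 (err0 d n a)).
    apply: (chain_norm_le q1 p1) => m; apply/andP; split; first exact: modulus_ge0.
    by have [] := block_pointwise d n a m.
  have Md : 0 <= M / delta by rewrite divr_ge0// ltW.
  exact: absorb_error Md (tau0 n a) (tauN n a).
move=> n a a0 j jn; apply: modulus_eq0.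
have N0 : N n a = 0.
  rewrite /N (_ : \sum_(_ < n) _ = 0) ?rnorm0//.
  transitivity (S (\sum_(j < n) a j *: d j)); last by rewrite a0 linear0.
  by rewrite linear_sum; apply: eq_bigr => i _; rewrite linearZ.
have t0 : tau n a = 0 by have := tauN n a; have := tau0 n a; rewrite N0; lra.
have := coef n a j; rewrite N0 t0 mul0rn addr0 pmulr_rle0// /alpha jn => le0.
by apply: le_anti; rewrite le0 modulus_ge0.
Qed.

End Blocks.
End ChainSpaceTheory.

Lemma sum_geometric_le (R : realType) (delta : R) n : 0 < delta ->
  \sum_(j < n) delta / 16 / 2 ^+ j <= delta / 8.
Proof.
move=> d0; suff -> : \sum_(j < n) delta / 16 / 2 ^+ j = delta / 8 - delta / 8 / 2 ^+ n.
  by rewrite gerBl// divr_ge0// ?exprn_ge0// divr_ge0// ltW.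
elim: n => [|n IH]; first by rewrite big_ord0 expr0 divr1 subrr.
rewrite big_ord_recr/= {}IH exprS.
by field; rewrite expf_neq0.
Qed.

Lemma geometric_term_lt (R : realType) (delta : R) n :
  0 < delta -> (delta / 16 / 2 ^+ n) *+ 2 < delta.
Proof.
move=> d0; apply: (@le_lt_trans _ _ (delta / 16 *+ 2)); last by lra.
rewrite lerMn2r/= ler_pdivrMr ?exprn_gt0// ler_peMr ?exprn_ege1//; first by lra.
by lra.
Qed.

(** * Limits along an ultrafilter *)

Section UltraLimits.
Variables (X : Type) (G : set_system X).
Hypothesis GU : UltraFilter G.

Lemma ultra_limit_real (R : realType) (r : X -> R) (B : R) :
  G [set x | `|r x| <= B] ->
  exists l, forall e, 0 < e -> G [set x | `|r x - l| <= e].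
Proof.
move=> GB.
have [l [_ lP]] : `[- B, B] `&` cluster (r @ G) !=set0.
  apply: segment_compact; apply: filterS GB => x /= rB.
  by rewrite in_itv/= -ler_norml; exact: rB.
exists l => e e0; have [//|nG] := in_ultra_setVsetC [set x | `|r x - l| <= e] GU.
have [_ [[x nx <-] /= xl]] := lP [set r x | x in ~` [set x | `|r x - l| <= e]]
  (ball l e) (filterS (fun x nx => ex_intro2 _ _ x nx erefl) nG) (nbhsx_ballx l e e0).
by exfalso; apply: nx; rewrite /= distrC ltW.
Qed.

Lemma ultra_limit_scalar (R : realType) (k : scalar_kind)
    (f : X -> scalars R k) (B : R) :
  G [set x | modulus (f x) <= B] ->
  exists z, forall e, 0 < e -> G [set x | modulus (f x - z) <= e].
Proof.
case: k f => f; first exact: ultra_limit_real.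
have re (z : R[i]) : `|complex.Re z| <= @modulus R ComplexScalars z.
  by case: z => a b /=; rewrite -sqrtr_sqr ler_wsqrtr// lerDl sqr_ge0.
have im (z : R[i]) : `|complex.Im z| <= @modulus R ComplexScalars z.
  by case: z => a b /=; rewrite -sqrtr_sqr ler_wsqrtr// lerDr sqr_ge0.
have le (z : R[i]) :
    @modulus R ComplexScalars z <= `|complex.Re z| + `|complex.Im z|.
  case: z => a b /=; rewrite -[leRHS]ger0_norm ?addr_ge0// -sqrtr_sqr.
  rewrite ler_wsqrtr// sqrrD !real_normK ?num_real// -addrA lerD2l lerDr.
  by rewrite mulrn_wge0// mulr_ge0.
move=> GB.
have [a aP] := @ultra_limit_real R (fun x => complex.Re (f x)) B
  (filterS (fun x fx => le_trans (re (f x)) fx) GB).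
have [b bP] := @ultra_limit_real R (fun x => complex.Im (f x)) B
  (filterS (fun x fx => le_trans (im (f x)) fx) GB).
exists (Complex a b : R[i]) => e e0.
have h0 : 0 < e / 2 by rewrite divr_gt0.
apply: filterS2 (aP _ h0) (bP _ h0) => x /= xa xb.
apply: le_trans (le _) _; rewrite (splitr e); apply: lerD.
  by move: xa; case: (f x).
by move: xb; case: (f x).
Qed.

Lemma filter_forall_ltn (P : nat -> set X) n :
  (forall i, G (P i)) -> G [set x | forall i, (i < n)%N -> P i x].
Proof.
move=> GP; elim: n => [|n IH]; first by apply: filterS filterT => x _ [].
apply: filterS2 IH (GP n) => x /= xi xn i.
by rewrite ltnS leq_eqVlt => /orP[/eqP ->//|/xi].
Qed.

End UltraLimits.

Lemma chain_norm_eq_on (R : realType) (q p : R) (C : seq {fset nat}) (f g : nat -> R) :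
  (forall F m, F \in C -> m \in F -> f m = g m) ->
  chain_norm q p f C = chain_norm q p g C.
Proof.
move=> fg; apply: lpnorm_eqr => F FC; apply: lpnorm_eqr => m mF.
exact: fg mF.
Qed.

Lemma chain_bounded (C : seq {fset nat}) :
  exists L, forall (F : {fset nat}) m, F \in C -> m \in F -> (m < L)%N.
Proof.
elim: C => [|F C [L LP]]; first by exists 0%N.
exists (maxn (\max_(m <- F) m).+1 L) => G m; rewrite inE leq_max.
case/predU1P => [-> mF|GC mG]; last by rewrite (LP G m GC mG) orbT.
by rewrite ltnS (big_rem m mF)/= leq_maxl.
Qed.

(** * Strictly singular operators on spaces normed by chains *)

Section ChainSpaceOperators.
Variables (R : realType) (k : scalar_kind) (q p : R) (full : bool).
Hypotheses (q1 : 1 <= q) (p1 : 1 <= p).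
Variables (E : normedModType (scalars R k)) (cE : chain_space q p full E).
Local Notation K := (scalars R k).
Local Notation c := (coord cE).
Local Notation nrm := (rnorm cE).
Implicit Types (x y : E).

Section GlidingHump.
Variable S : {linear E -> E}.

Lemma small_tail2 x y n e : 0 < e -> exists2 s, (n < s)%N &
  forall C, admissible full C ->
    chain_norm q p (fun m => if (m < s)%N then 0 else modulus (c x m)) C <= e /\
    chain_norm q p (fun m => if (m < s)%N then 0 else modulus (c y m)) C <= e.
Proof.
move=> e0; have [s1 s1P] := small_tail cE x e0; have [s2 s2P] := small_tail cE y e0.
exists (maxn n.+1 (maxn s1 s2)); first by rewrite leq_max leqnn.
have later z s s' C : (s <= s')%N ->
    chain_norm q p (fun m => if (m < s')%N then 0 else modulus (c z m)) C <=
    chain_norm q p (fun m => if (m < s)%N then 0 else modulus (c z m)) C.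
  move=> ss'; apply: (chain_norm_le q1 p1) => m.
  case: (ltnP m s') => [_|ms']; first by case: ifP => _; rewrite lexx ?modulus_ge0.
  by rewrite ltnNge (leq_trans ss' ms')/= lexx modulus_ge0.
by move=> C aC; split; [apply: le_trans (later _ _ _ _ _) (s1P C aC)
  |apply: le_trans (later _ _ _ _ _) (s2P C aC)]; rewrite !leq_max leqnn !orbT.
Qed.

(** There are [n] coordinates, and each costs at most [e / n.+1]. *)
Lemma small_head x n e C : 0 < e -> successive C ->
  (forall i, (i < n)%N -> modulus (c x i) <= e / n.+1%:R) ->
  chain_norm q p (fun m => if (m < n)%N then modulus (c x m) else 0) C <= e.
Proof.
move=> e0 sC xe.
have f0 m : 0 <= if (m < n)%N then modulus (c x m) else 0.
  by case: ifP => // _; exact: modulus_ge0.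
apply: (le_trans (chain_norm_le_sum q1 p1 (n := n) sC f0 _)).
  by move=> m; rewrite ltnNge => ->.
apply: (@le_trans _ _ (\sum_(m < n) e / n.+1%:R)).
  by apply: ler_sum => m _; rewrite ltn_ord; exact: xe.
rewrite sumr_const card_ord -[leLHS]mulr_natr mulrAC ler_pdivrMr ?ltr0n//.
by rewrite ler_pM2l// ler_nat.
Qed.

Lemma block_index (s : nat -> nat) : s 0%N = 0%N -> (forall j, (s j < s j.+1)%N) ->
  exists b, forall m, (s (b m) <= m < s (b m).+1)%N.
Proof.
move=> s0 sS; suff /choice[b bP] : forall m, exists j, (s j <= m < s j.+1)%N.
  by exists b.
move=> m; have sj j : (j <= s j)%N by elim: j => // j /leq_ltn_trans; apply.
have ex : exists j, (m < s j.+1)%N by exists m; exact: sj.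
case: (ex_minnP ex) => -[|j] mj jmin; first by exists 0%N; rewrite s0.
exists j.+1; rewrite mj andbT leqNgt; apply/negP => /jmin.
by rewrite ltnn.
Qed.

(** The vectors are chosen one after the other, each with small coordinates in
    the part of the index set that the blocks of the earlier vectors use up. *)
Lemma gliding_hump (Q : nat -> R -> E -> Prop) (eps : nat -> R) :
  (forall j, 0 < eps j) ->
  (forall n e, 0 < e -> exists2 x, Q n e x & forall i, (i < n)%N ->
     modulus (c x i) <= e /\ modulus (c (S x) i) <= e) ->
  exists (s b : nat -> nat) (d : nat -> E),
    [/\ forall m, (s (b m) <= m < s (b m).+1)%N,
        {homo s : m n / (m <= n)%N},
        forall j, Q (s j) (eps j / (s j).+1%:R) (d j),
        forall j, almost_in_block cE s eps (d j) j &
        forall j, almost_in_block cE s eps (S (d j)) j].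
Proof.
move=> eps0 ex.
have /choice[f fP] : forall nj : nat * nat, exists x,
    Q nj.1 (eps nj.2 / nj.1.+1%:R) x /\ forall i, (i < nj.1)%N ->
      modulus (c x i) <= eps nj.2 / nj.1.+1%:R /\
      modulus (c (S x) i) <= eps nj.2 / nj.1.+1%:R.
  move=> [n j]/=; have [x Qx xe] := ex n _ (divr_gt0 (eps0 j) (ltr0Sn _ n)).
  by exists x.
have /choice[g gP] : forall nj : nat * nat, exists t, (nj.1 < t)%N /\
    forall C, admissible full C ->
      chain_norm q p (fun m => if (m < t)%N then 0 else modulus (c (f nj) m)) C
        <= eps nj.2 /\
      chain_norm q p (fun m => if (m < t)%N then 0 else modulus (c (S (f nj)) m)) C
        <= eps nj.2.
  move=> nj; have [t nt tP] := small_tail2 (f nj) (S (f nj)) nj.1 (eps0 nj.2).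
  by exists t.
pose s := fix s j := if j is i.+1 then g (s i, i) else 0%N.
have sS j : (s j < s j.+1)%N by have [] := gP (s j, j).
have [b sb] := block_index (erefl : s 0%N = 0%N) sS.
exists s, b, (fun j => f (s j, j)); split=> //.
- by apply: homo_leq => // [x y z|j]; [exact: leq_trans|exact: ltnW].
- by move=> j; have [] := fP (s j, j).
- move=> j C aC; have [_ fe] := fP (s j, j); have [_ /(_ C aC)[ge _]] := gP (s j, j).
  split; last exact: ge.
  by apply: small_head; [exact: eps0|case/and3P: aC|move=> i /fe[]].
- move=> j C aC; have [_ fe] := fP (s j, j); have [_ /(_ C aC)[_ ge]] := gP (s j, j).
  split; last exact: ge.
  by apply: small_head; [exact: eps0|case/and3P: aC|move=> i /fe[]].
Qed.

Hypotheses (S_bounded : bounded_operator S) (S_ss : strictly_singular S).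

(** Otherwise there are almost disjoint blocks [d j] whose images have a large
    coordinate [k j] in the same block; then the [S (d j)] dominate the unit
    vectors at the [k j], and these dominate the [d j]. *)
Lemma small_image_coordinates (M delta : R) : 0 <= M -> 0 < delta ->
  exists n e, 0 < e /\ forall x, nrm x <= M ->
    (forall i, (i < n)%N -> modulus (c x i) <= e /\ modulus (c (S x) i) <= e) ->
    forall l, modulus (c (S x) l) < delta.
Proof.
move=> M0 d0; apply: contrapT => none.
(* These errors have sum at most [delta / 8], as [block_domination] requires. *)
pose eps j : R := delta / 16 / 2 ^+ j.
have eps0 j : 0 < eps j by rewrite divr_gt0// ?exprn_gt0// divr_gt0.
have epsS n : \sum_(j < n) eps j <= delta / 8 by exact: sum_geometric_le.
have eps_lt j : eps j *+ 2 < delta by exact: geometric_term_lt.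
have := gliding_hump (Q := fun _ _ x => nrm x <= M /\
  exists l, delta <= modulus (c (S x) l)) eps0.
case.
  move=> n e e0; apply: contrapT => no; apply: none; exists n, e; split=> //.
  move=> x xM xe l; rewrite ltNge; apply/negP => lx; apply: no.
  by exists x => //; split=> //; exists l.
move=> s [b [d [sb s_mono dQ d_in Sd_in]]].
have /choice[l lP] : forall j, exists l, delta <= modulus (c (S (d j)) l).
  by move=> j; have [_] := dQ j.
have bl j : b (l j) = j.
  apply/eqP; apply: contraT => bj.
  have [C aC] := chain_norm_point full (l j) q1 p1 (off_block_ge0 cE b (S (d j)) j).
  rewrite {1}/off_block (negbTE bj) => le.
  have := le_trans (lP j) (le_trans le
    (chain_norm_off_block q1 p1 sb s_mono (Sd_in j) aC)).
  by rewrite leNgt eps_lt.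
have eta0 m : 0 <= modulus (c (S (d (b m))) m) by exact: modulus_ge0.
have xi0 m : 0 <= modulus (c (d (b m)) m) by exact: modulus_ge0.
have b_mono := block_mono sb s_mono.
apply: (block_domination q1 p1 sb s_mono S_bounded (fun j => ltW (eps0 j)) d0 M0
  epsS d_in Sd_in _ _ S_ss).
- move=> j.
  pose f m := if b m == j then modulus (c (S (d (b m))) m) else 0.
  have f0 m : 0 <= f m by rewrite /f; case: ifP.
  have [C aC le] := chain_norm_point full (l j) q1 p1 f0.
  exists C => //; apply: le_trans le; rewrite /f bl eqxx; exact: lP.
- move=> alpha n r C alpha0 _ le aC.
  apply: le_trans (chain_norm_large_coordinates q1 p1 b_mono xi0 eta0 alpha0 d0
    M0 _ le bl _ aC) _.
  + move=> j D aD; apply: le_trans (proj1 (dQ j)).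
    apply: le_trans (chain_norm_le_rnorm cE (d j) aD).
    apply: (chain_norm_le q1 p1) => m.
    by case: eqVneq => [->|_]; rewrite ?lexx ?modulus_ge0.
  + by move=> j; rewrite bl.
  rewrite lerDl; apply: sumr_ge0 => j _; apply: mulr_ge0 => //; exact: ltW.
Qed.

(** Otherwise there are almost disjoint blocks [d j] with rapidly decreasing
    coordinates, which behave like the unit vectors of [l_p] or [c_0], whereas the
    [S (d j)] satisfy the corresponding lower estimate. *)
Lemma small_image_norm (M delta : R) : 0 <= M -> 0 < delta ->
  exists n e, 0 < e /\ forall x, nrm x <= M ->
    (forall i, modulus (c x i) <= e) ->
    (forall i, (i < n)%N -> modulus (c (S x) i) <= e) ->
    nrm (S x) < delta.
Proof.
move=> M0 delta0; apply: contrapT => none.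
(* Restricting [S (d j)] to its block may cost up to half of its norm. *)
pose dl := delta / 2; have d0 : 0 < dl by rewrite divr_gt0.
(* These errors have sum at most [dl / 8], as [block_domination] requires. *)
pose eps j : R := dl / 16 / 2 ^+ j.
have eps0 j : 0 < eps j by rewrite divr_gt0// ?exprn_gt0// divr_gt0.
have epsS n : \sum_(j < n) eps j <= dl / 8 by exact: sum_geometric_le.
have eps_lt j : eps j *+ 2 < dl by exact: geometric_term_lt.
have := gliding_hump (Q := fun _ e x => [/\ nrm x <= M,
  forall i, modulus (c x i) <= e & delta <= nrm (S x)]) eps0.
case.
  move=> n e e0; apply: contrapT => no; apply: none; exists n, e; split=> //.
  move=> x xM xe Sxe; rewrite ltNge; apply/negP => lx; apply: no.
  by exists x => // i ni; split; [exact: xe|exact: Sxe].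
move=> s [b [d [sb s_mono dQ d_in Sd_in]]].
have eta0 m : 0 <= modulus (c (S (d (b m))) m) by exact: modulus_ge0.
have xi0 m : 0 <= modulus (c (d (b m)) m) by exact: modulus_ge0.
have b_mono := block_mono sb s_mono.
have eta_ge j : exists2 C, admissible full C & dl <=
    chain_norm q p (fun m => if b m == j then modulus (c (S (d (b m))) m) else 0) C.
  apply: contrapT => no; have [_ _] := dQ j; apply/negP; rewrite -ltNge.
  apply: (@le_lt_trans _ _ (dl + eps j *+ 2)); last first.
    by rewrite [ltRHS](splitr delta) ltrD2l.
  apply: rnorm_le => C aC.
  have f0 m : 0 <= if b m == j then modulus (c (S (d (b m))) m) else 0 by case: ifP.
  have le : chain_norm q p
      (fun m => if b m == j then modulus (c (S (d (b m))) m) else 0) C <= dl.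
    by rewrite leNgt; apply/negP => /ltW lt; apply: no; exists C.
  apply: le_trans (lerD le (chain_norm_off_block q1 p1 sb s_mono (Sd_in j) aC)).
  apply: le_trans (chain_normD q1 p1 C f0 (off_block_ge0 cE b (S (d j)) j)).
  apply: (chain_norm_le q1 p1) => m; rewrite modulus_ge0/= /off_block.
  by case: eqVneq => [->|_]; rewrite ?addr0 ?add0r.
have [mn mnP] := fset_min_exists.
apply: (block_domination q1 p1 sb s_mono S_bounded (fun j => ltW (eps0 j)) d0 M0
  epsS d_in Sd_in eta_ge _ S_ss).
move=> alpha n r C alpha0 alphan le aC.
apply: le_trans (chain_norm_small_blocks q1 p1 b_mono xi0 eta0 alpha0 d0 M0 _ le
  eta_ge mnP (eps := eps) _ _ alphan aC) _.
- move=> j D aD; have [dM _ _] := dQ j; apply: le_trans dM.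
  apply: le_trans (chain_norm_le_rnorm cE (d j) aD).
  apply: (chain_norm_le q1 p1) => m.
  by case: eqVneq => [->|_]; rewrite ?lexx ?modulus_ge0.
- by move=> j; exact: ltW.
- move=> m m' bm; have [_ /(_ m) dm _] := dQ (b m).
  apply: (@le_trans _ _ ((s (b m)).+1%:R * (eps (b m) / (s (b m)).+1%:R))).
    apply: ler_pM => //.
    rewrite ler_nat ltnS; have /andP[_ ms] := sb m'.
    exact: leq_trans (ltnW ms) (s_mono _ _ bm).
  by rewrite mulrC divfK// pnatr_eq0.
have r0 : 0 <= r by apply: le_trans (le C aC); exact: chain_norm_ge0.
by rewrite lerD2r mulr2n lerDl; apply: mulr_ge0 r0; rewrite divr_ge0// ltW.
Qed.

End GlidingHump.

Section Composition.
Variables T U : {linear E -> E}.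
Hypotheses (T_bounded : bounded_operator T) (U_bounded : bounded_operator U).
Hypotheses (T_ss : strictly_singular T) (U_ss : strictly_singular U).

Lemma small_composite (M delta : R) : 0 <= M -> 0 < delta ->
  exists n e, 0 < e /\ forall x, nrm x <= M ->
    (forall i, (i < n)%N -> [/\ modulus (c x i) <= e, modulus (c (U x) i) <= e &
      modulus (c (T (U x)) i) <= e]) ->
    nrm (T (U x)) < delta.
Proof.
move=> M0 d0; have [B B0 UB] := bounded_operator_real cE U_bounded.
have [n2 [e2 [e20 He2]]] := small_image_norm T_bounded T_ss (mulr_ge0 B0 M0) d0.
have [n1 [e1 [e10 He1]]] := small_image_coordinates U_bounded U_ss M0 e20.
exists (maxn n1 n2), (Num.min e1 e2); split; first by rewrite lt_min e10.
move=> x xM xe; apply: He2.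
- by apply: le_trans (UB x) _; apply: ler_wpM2l.
- move=> i; apply/ltW; apply: He1 => // j jn.
  have [|xj Uxj _] := xe j; first by rewrite leq_max jn.
  by split; [move: xj|move: Uxj]; rewrite le_min => /andP[].
- move=> i ni; have [|_ _] := xe i; first by rewrite leq_max ni orbT.
  by rewrite le_min => /andP[].
Qed.

(** Two vectors of the ball whose coordinates, and those of their images, are near
    the limits have a difference to which [small_composite] applies; this turns
    coordinatewise convergence of the images into convergence in norm. *)
Lemma composite_ultra_limit (G : set_system E) : UltraFilter G ->
  G [set x | nrm x <= 1] ->
  exists w, forall e, 0 < e -> G [set x | nrm (T (U x) - w) <= e].
Proof.
move=> GU G1.
have [BT BT0 TB] := bounded_operator_real cE T_bounded.
have [BU BU0 UB] := bounded_operator_real cE U_bounded.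
have U1 x : nrm x <= 1 -> nrm (U x) <= BU.
  by move=> x1; rewrite (le_trans (UB x))// ler_piMr.
have lim (f : E -> E) B : (forall x, nrm x <= 1 -> nrm (f x) <= B) ->
    exists z : nat -> K, forall i e, 0 < e ->
      G [set x | modulus (c (f x) i - z i) <= e].
  move=> fB; suff /choice[z zP] : forall i, exists z, forall e, 0 < e ->
      G [set x | modulus (c (f x) i - z) <= e] by exists z.
  move=> i; apply: (@ultra_limit_scalar _ _ GU _ _ (fun x => c (f x) i) B).
  apply: filterS G1 => x /= x1.
  exact: le_trans (coord_le_rnorm q1 p1 cE (f x) i) (fB x x1).
have [z0 z0P] := lim id 1 (fun _ le1 => le1).
have [z1 z1P] := lim U BU U1.
have [z zP] := lim (T \o U) (BT * BU)
  (fun x le1 => le_trans (TB (U x)) (ler_wpM2l BT0 (U1 x le1))).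
pose dist x m := modulus (z m - c (T (U x)) m).
have dist0 x m : 0 <= dist x m by exact: modulus_ge0.
have distC x m : dist x m = modulus (c (T (U x)) m - z m).
  by rewrite /dist -opprB modulusN.
have near e : 0 < e -> G [set x | forall C, admissible full C ->
    chain_norm q p (dist x) C <= e].
  move=> e0; have [//|Gfar] := in_ultra_setVsetC [set x | forall C,
    admissible full C -> chain_norm q p (dist x) C <= e] GU.
  exfalso; have [n [h [h0 Hsmall]]] := small_composite (ler0n _ 2) e0.
  have h20 : 0 < h / 2 by rewrite divr_gt0.
  have Gn : G [set x | forall i, (i < n)%N -> [/\ modulus (c x i - z0 i) <= h / 2,
      modulus (c (U x) i - z1 i) <= h / 2 & modulus (c (T (U x)) i - z i) <= h / 2]].
    apply: filter_forall_ltn => i.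
    apply: filterS3 (z0P i _ h20) (z1P i _ h20) (zP i _ h20) => x /=.
    by split.
  have [x [/= xfar [x1 xn]]] := filter_ex (filterI Gfar (filterI G1 Gn)).
  have [C [aC Ce]] : exists C, admissible full C /\ e < chain_norm q p (dist x) C.
    apply: contrapT => no; apply: xfar => C aC; rewrite leNgt; apply/negP => lt.
    by apply: no; exists C.
  (* A chain sees finitely many coordinates only, so some [y] near the limit is
     indistinguishable from the limit along [C]. *)
  have [L LP] := chain_bounded C.
  pose a := chain_norm q p (dist x) C - e.
  have a0 : 0 < a by rewrite subr_gt0.
  have aL : 0 < a / L.+1%:R by rewrite divr_gt0.
  have GL : G [set y | forall i, (i < L)%N ->
      modulus (c (T (U y)) i - z i) <= a / L.+1%:R].
    by apply: filter_forall_ltn => i; exact: zP.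
  have [y [y1 [yn /= yL]]] := filter_ex (filterI G1 (filterI Gn GL)).
  have ya : chain_norm q p (dist y) C <= a.
    have f0 m : 0 <= if (m < L)%N then dist y m else 0 by case: ifP.
    rewrite (@chain_norm_eq_on _ _ _ _ _
      (fun m => if (m < L)%N then dist y m else 0)); last first.
      by move=> F m FC mF; rewrite (LP F m FC mF).
    have [_ sC _] := and3P aC.
    apply: (le_trans (chain_norm_le_sum q1 p1 (n := L) sC f0 _)).
      by move=> m; rewrite ltnNge => ->.
    apply: (@le_trans _ _ (\sum_(m < L) a / L.+1%:R)).
      by apply: ler_sum => m _; rewrite ltn_ord distC; exact: yL.
    rewrite sumr_const card_ord -[leLHS]mulr_natr mulrAC ler_pdivrMr ?ltr0n//.
    by rewrite ler_pM2l// ler_nat.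
  have half (s t u : K) : modulus (s - u) <= h / 2 -> modulus (t - u) <= h / 2 ->
      modulus (s - t) <= h.
    move=> su tu; rewrite (splitr h) -(subrKA u).
    apply: le_trans (ler_modulusD _ _) (lerD su _).
    by rewrite -opprB modulusN.
  have : nrm (T (U (x - y))) < e.
    apply: Hsmall.
      apply: le_trans (ler_rnormD cE x (- y)) _; rewrite rnormN.
      exact: lerD x1 y1.
    move=> i ni; have [xa xb xc] := xn i ni; have [ya' yb yc] := yn i ni.
    by rewrite !linearB !coordB; split; [exact: half xa ya'|exact: half xb yb
      |exact: half xc yc].
  apply/negP; rewrite -leNgt.
  have -> : e = chain_norm q p (dist x) C - a by rewrite /a opprB addrC subrK.
  rewrite lerBlDr; apply: le_trans (lerD (chain_norm_le_rnorm cE _ aC) ya).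
  apply: le_trans (chain_normD q1 p1 C
    (fun m => modulus_ge0 (c (T (U (x - y))) m)) (dist0 y)).
  apply: (chain_norm_le q1 p1) => m; rewrite dist0/= !linearB coordB !distC.
  rewrite -(subrKA (c (T (U y)) m)).
  exact: ler_modulusD.
have [w wz] : exists w, c w = z.
  apply: (@coord_complete _ _ _ _ _ _ cE z) => e e0.
  by have [x xe] := filter_ex (near e e0); exists (T (U x)).
exists w => e e0; apply: filterS (near e e0) => x /= xe.
apply: rnorm_le => C aC; apply: le_trans (xe C aC).
apply: (chain_norm_le q1 p1) => m.
by rewrite modulus_ge0/= coordB wz distC.
Qed.

(** A filter that contains the closure of the image of the ball need not contain
    the image itself. It is lifted to the filter on the ball generated by the sets
    of the [x] whose image is near a given member; an ultrafilter that refines the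
    latter has a limit, which is a cluster point of the former. *)
Lemma composite_compact : compact_operator (T \o U).
Proof.
rewrite /compact_operator precompactE => F FF FA.
set A := _ @` _ in FA *.
pose D := [set Ve : set E * R | F Ve.1 /\ 0 < Ve.2].
pose B (Ve : set E * R) := [set x : E | nrm x <= 1 /\
  exists2 y, Ve.1 y & nrm (T (U x) - y) < Ve.2].
have D_filter : ProperFilter (filter_from D B).
  apply: filter_from_proper.
    apply: filter_from_filter; first by exists (setT, 1); split=> //; exact: filterT.
    move=> [V e] [V' e'] [/= FV e0] [/= FV' e0'].
    exists (V `&` V', Num.min e e'); first by split; [exact: filterI|rewrite lt_min e0].
    move=> x [x1 [y [Vy V'y]]]; rewrite lt_min => /andP[ye ye'].
    by split; split=> //; exists y.
  move=> [V e] [/= FV e0].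
  have [y [Vy yA]] := filter_ex (filterI FV FA).
  have [_ [[x /(rnorm_le1 cE) x1 <-] xy]] := yA [set z | nrm (z - y) < e]
    (proj2 (nbhs_rnormP cE y _) (ex_intro2 _ _ e e0 (fun _ => id))).
  by exists x; split=> //; exists y.
have [G [GU DG]] := ultraFilterLemma D_filter.
have GB V e : F V -> 0 < e -> G (B (V, e)) by move=> FV e0; apply: DG; exists (V, e).
have G1 : G [set x | nrm x <= 1].
  by apply: filterS (GB _ _ filterT ltr01) => x [].
have [w wP] := composite_ultra_limit GU G1.
exists w; split.
  move=> N /(nbhs_rnormP cE)[e e0 eN].
  have [x [x1 xw]] := filter_ex (filterI G1 (wP (e / 2) (divr_gt0 e0 (ltr0n _ 2)))).
  exists (T (U x)); split; last first.
    by apply: eN; rewrite (le_lt_trans xw)// ltr_pdivrMr// ltr_pMr// ltr1n.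
  by exists x => //; exact/(rnorm_le1 cE).
move=> V N FV /(nbhs_rnormP cE)[e e0 eN].
have h0 : 0 < e / 2 by rewrite divr_gt0.
have [x [[_ [y Vy xy]] xw]] := filter_ex (filterI (GB V _ FV h0) (wP _ h0)).
exists y; split=> //; apply: eN.
rewrite -(subrKA (T (U x))) (splitr e).
apply: le_lt_trans (ler_rnormD cE _ _) (ltr_leD _ xw).
by rewrite -opprB rnormN.
Qed.

End Composition.
End ChainSpaceOperators.

(** * The Schreier spaces *)

Section SchreierSpace.
Variables (R : realType) (k : scalar_kind) (p : R).
Hypothesis p1 : 1 <= p.
Local Notation Z := (schreier_Z k p1).
Local Notation E := (schreier_space k p1).
Local Notation normZ z := (fine (schreier_norm p (coords z))).

Lemma schreier_chain_norm_le (z : Z) C : admissible false C ->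
  chain_norm p 1 (fun m => modulus (coords z m)) C <= normZ z.
Proof.
move=> /and3P[sC _ sizeC]; rewrite -lee_fin (fine_enorm z).
case: C sC sizeC => [_ _|F []//].
  by rewrite chain_norm_nil//; exact: enorm_ge0.
rewrite /= andbT => sF _; rewrite chain_norm1//.
by apply: ereal_sup_ubound; exists F.
Qed.

Lemma schreier_norm_le (x : nat -> scalars R k) r :
  (forall C, admissible false C -> chain_norm p 1 (fun m => modulus (x m)) C <= r) ->
  (schreier_norm p x <= r%:E)%E.
Proof.
move=> xr; apply: ge_ereal_sup => _ [F sF <-]; rewrite lee_fin schreier_muE.
by rewrite -(chain_norm1 p (lexx 1)) xr// /admissible/= sF.
Qed.

Lemma schreier_norm_ler (z : Z) r :
  (forall C, admissible false C ->
    chain_norm p 1 (fun m => modulus (coords z m)) C <= r) -> normZ z <= r.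
Proof. by move=> zr; rewrite -lee_fin (fine_enorm z); exact: schreier_norm_le. Qed.

Lemma schreier_span_finite (y : Z) : linear_span (range (schreier_basis k p1)) y ->
  exists s, forall m, (s <= m)%N -> coords y m = 0.
Proof.
move=> [n [a [v [vP ->]]]]; elim: n a v vP => [|n IH] a v vP.
  by exists 0%N => m _; rewrite big_ord0.
have [s sP] := IH (a \o lift ord0) (v \o lift ord0) (fun i => vP _).
have [j _ vj] := vP ord0.
exists (maxn s j.+1) => m; rewrite geq_max => /andP[sm jm].
rewrite big_ord_recl -vj.
have := sP m sm => /= sum0.
change (a ord0 * unit_vector R k j m +
  coords (\sum_(i < n) (a \o lift ord0) i *: (v \o lift ord0) i) m = 0).
by rewrite sum0 /unit_vector gtn_eqF// mulr0 addr0.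
Qed.

Lemma closed_span_approx (A : set Z) (z : Z) e : 0 < e -> z \in closed_span A ->
  exists2 y, linear_span A y & normZ (z - y) < e.
Proof.
move=> e0; rewrite inE => /(_ (ball z (of_real k e))).
case; first by apply: nbhsx_ballx; rewrite -(of_real0 R k) ltr_of_real.
move=> y [Ay]; rewrite -ball_normE /= => zy; exists y => //.
by move: zy; rewrite finite_norm_spaceE ltr_of_real.
Qed.

(** A vector of the closed span is near a finitely supported one, and beyond the
    support its tail is that of the difference. *)
Lemma schreier_small_tail (x : E) e : 0 < e -> exists s, forall C,
  admissible false C -> chain_norm p 1
    (fun m => if (m < s)%N then 0 else modulus (coords (inclusion x) m)) C <= e.
Proof.
move=> e0; have [y Ay ye] := closed_span_approx e0 (inclusionP x).
have [s sP] := schreier_span_finite Ay.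
exists s => C aC; apply: le_trans (ltW ye).
apply: le_trans (schreier_chain_norm_le _ aC).
apply: (chain_norm_le p1 (lexx 1)) => m.
case: ltnP => [_|sm]; first by rewrite lexx modulus_ge0.
rewrite modulus_ge0/=; change (modulus (coords (inclusion x) m) <=
  modulus (coords (inclusion x) m - coords y m)).
by rewrite sP// subr0.
Qed.

Lemma schreier_complete (z : nat -> scalars R k) :
  (forall e, 0 < e -> exists y : E, forall C, admissible false C ->
    chain_norm p 1 (fun m => modulus (z m - coords (inclusion y) m)) C <= e) ->
  exists x : E, coords (inclusion x) = z.
Proof.
move=> zP.
have zfin : z \in finite_enorm (schreier_enorm k p1).
  have [y yP] := zP 1 ltr01; rewrite unfold_in.
  rewrite (_ : z = (z - coords (inclusion y)) + coords (inclusion y)); last first.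
    by rewrite subrK.
  apply: le_lt_trans (enormD _ _ _) _; rewrite lte_add_pinfty//.
    by apply: le_lt_trans (schreier_norm_le yP) (ltry _).
  by have := coordsP (inclusion y); rewrite unfold_in.
pose zZ : Z := FiniteNormSpace zfin.
have zX : zZ \in closed_span (range (schreier_basis k p1)).
  rewrite inE; apply: closed_closure => B /nbhs_normP[e /= e0 eB].
  have e0' : 0 < modulus e / 2.
    by rewrite divr_gt0// -(ltr_of_real k) of_real0 -normr_modulus normr_gt0 gt_eqF.
  have [y yP] := zP _ e0'.
  exists (inclusion y); split; first by have := inclusionP y; rewrite inE.
  apply: eB => /=; rewrite -[e in _ < e]gtr0_norm// normr_modulus.
  rewrite finite_norm_spaceE ltr_of_real.
  apply: (@le_lt_trans _ _ (modulus e / 2)).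
    by apply: schreier_norm_ler; exact: yP.
  by rewrite ltr_pdivrMr// ltr_pMr ?ltr1n// -[modulus e]divr1; lra.
by exists (LinearSubspace zX).
Qed.

Lemma schreier_chain_space : chain_space p 1 false E.
Proof.
pose c (x : E) := coords (inclusion x).
have cD (x y : E) m : c (x + y) m = c x m + c y m by [].
have cZ a (x : E) m : c (a *: x) m = a * c x m.
  have incZ : inclusion (a *: x) = a *: inclusion x by [].
  have cooZ (z : Z) : coords (a *: z) = a *: coords z by [].
  by rewrite /c incZ cooZ.
have nE (x : E) : `|x| = of_real k (normZ (inclusion x)) by [].
have le (x : E) C := @schreier_chain_norm_le (inclusion x) C.
have ler (x : E) r := @schreier_norm_ler (inclusion x) r.
exact: (ChainSpace cD cZ nE le ler schreier_small_tail schreier_complete).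
Qed.

End SchreierSpace.

(** * The Baernstein spaces *)

(** A chain that almost attains the norm can be continued by any chain that lies
    to the right of it; the [p]-th powers add up, so that such a chain cannot
    contribute much. *)
Lemma full_chain_small_tail (R : realType) (q p N : R) (f : nat -> R) e :
  1 <= q -> 1 <= p -> (forall m, 0 <= f m) -> 0 < e ->
  (forall C, admissible true C -> chain_norm q p f C <= N) ->
  (forall r, (forall C, admissible true C -> chain_norm q p f C <= r) -> N <= r) ->
  exists s, forall C, admissible true C ->
    chain_norm q p (fun m => if (m < s)%N then 0 else f m) C <= e.
Proof.
move=> q1 p1 f0 e0 fN Nle.
have p0 : 0 < p by exact: lt_le_trans p1.
have [Ne|eN] := leP N e.
  by exists 0%N => C aC; apply: le_trans (fN C aC) Ne.
have N0 : 0 < N by exact: lt_trans eN.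
(* If a chain attains at least [t], at most [e] is left for the chains beyond it. *)
pose t := (N `^ p - e `^ p) `^ p^-1.
have d0 : 0 <= N `^ p - e `^ p.
  by rewrite subr_ge0; apply: (ler_powRp p1) => //; exact: ltW.
have tp : t `^ p = N `^ p - e `^ p.
  by rewrite /t -powRrM mulVf ?powRr1// gt_eqF.
have [C aC tC] : exists2 C, admissible true C & t < chain_norm q p f C.
  apply: contrapT => no.
  have : N <= t.
    apply: Nle => C aC; rewrite leNgt; apply/negP => lt.
    by apply: no; exists C.
  move=> /(ler_powRp p1 (ltW N0)); rewrite tp.
  by rewrite -subr_ge0 addrC addKr oppr_ge0 leNgt powR_gt0.
have [L LP] := chain_bounded C.
exists L => D aD.
pose cut (F : {fset nat}) := [fset m in F | (L <= m)%N]%fset.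
have aCD : admissible true (C ++ map cut D).
  case/and3P: aC aD => sC succC _ /and3P[sD succD _].
  rewrite /admissible/= andbT all_cat sC/=; apply/andP; split.
    apply/allP => _ /mapP[F FD ->]; apply: schreier_set_sub (allP sD F FD).
    by apply/fsubsetP => m; rewrite !inE => /andP[].
  rewrite /successive pairwise_cat -/(successive _) succC/= pairwise_map.
  apply/andP; split.
    apply/allrelP => F _ FC /mapP[G GD ->]; apply/allrelP => m n mF.
    by rewrite !inE => /andP[_]; apply: leq_trans; exact: LP mF.
  apply: sub_pairwise succD => F G /allrelP FG; apply/allrelP => m n.
  by rewrite !inE => /andP[mF _] /andP[nG _]; exact: FG.
have E0 : chain_norm q p f (C ++ map cut D) `^ p = chain_norm q p f C `^ p +
    chain_norm q p (fun m => if (m < L)%N then 0 else f m) D `^ p.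
  rewrite [LHS](chain_norm_powR q p1) [X in _ = X + _](chain_norm_powR q p1).
  rewrite [X in _ = _ + X](chain_norm_powR q p1).
  rewrite big_cat.
  rewrite (big_map cut xpredT (fun F : {fset nat} => lpnorm q F f `^ p)).
  apply: (f_equal (+%R _)).
  apply: eq_bigr => F _; rewrite (lpnorm_fset_filter _ _ _ q1).
  apply: (f_equal (@powR R ^~ p)); apply: lpnorm_eqr => m _.
  by case: leqP.
have le1 := ler_powRp p1 (chain_norm_ge0 q p f _) (fN _ aCD).
have le2 := ler_powRp p1 (powR_ge0 _ _) (ltW tC).
rewrite E0 in le1; rewrite tp in le2.
rewrite leNgt; apply/negP => lt.
have lt2 : e `^ p < chain_norm q p (fun m => if (m < L)%N then 0 else f m) D `^ p.
  apply: (gt0_ltr_powR p0 _ _ lt); first by rewrite nnegrE ltW.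
  by rewrite nnegrE; exact: chain_norm_ge0.
by have := lt_le_trans (ler_ltD le2 lt2) le1; rewrite subrK ltxx.
Qed.

Section BaernsteinSpace.
Variables (R : realType) (k : scalar_kind) (p : R).
Hypothesis p_gt1 : 1 < p.
Let p1 : 1 <= p. Proof. exact: ltW. Qed.
Local Notation E := (baernstein_space k p_gt1).
Local Notation normE x := (fine (baernstein_norm p (coords x))).

Lemma baernstein_betaE1 (x : nat -> scalars R k) C :
  baernstein_beta p x C = chain_norm 1 p (fun m => modulus (x m)) C.
Proof.
by rewrite baernstein_betaE chain_norm_q1// => m; exact: modulus_ge0.
Qed.

Lemma baernstein_chain_norm_le (x : E) C : admissible true C ->
  chain_norm 1 p (fun m => modulus (coords x m)) C <= normE x.
Proof.
move=> /and3P[sC succC _]; rewrite -lee_fin (fine_enorm x).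
rewrite -(chain_norm_drop_empty (lexx 1) p1 _ C).
set C' := [seq F <- C | F != fset0].
have [->|C0] := eqVneq C' [::]; first by rewrite chain_norm_nil//; exact: enorm_ge0.
rewrite -baernstein_betaE1; apply: ereal_sup_ubound; exists C' => //=.
apply/and3P; split=> //.
  apply/allP => F; rewrite mem_filter => /andP[-> FC]/=; exact: (allP sC).
exact: pairwise_filter.
Qed.

Lemma baernstein_norm_le (x : nat -> scalars R k) r :
  (forall C, admissible true C -> chain_norm 1 p (fun m => modulus (x m)) C <= r) ->
  (baernstein_norm p x <= r%:E)%E.
Proof.
move=> xr; apply: ge_ereal_sup => _ [C /and3P[_ sC succC] <-].
rewrite lee_fin baernstein_betaE1; apply: xr; rewrite /admissible andbT.
apply/andP; split=> //; apply/allP => F FC.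
by have /andP[] := allP sC F FC.
Qed.

Lemma baernstein_norm_ler (x : E) r :
  (forall C, admissible true C ->
    chain_norm 1 p (fun m => modulus (coords x m)) C <= r) -> normE x <= r.
Proof. by move=> xr; rewrite -lee_fin (fine_enorm x); exact: baernstein_norm_le. Qed.

Lemma baernstein_small_tail (x : E) e : 0 < e -> exists s, forall C,
  admissible true C ->
  chain_norm 1 p (fun m => if (m < s)%N then 0 else modulus (coords x m)) C <= e.
Proof.
move=> e0; apply: (full_chain_small_tail (N := normE x)) => //.
- by move=> m; exact: modulus_ge0.
- by move=> C; exact: baernstein_chain_norm_le.
- by move=> r; exact: baernstein_norm_ler.
Qed.

Lemma baernstein_complete (z : nat -> scalars R k) :
  (forall e, 0 < e -> exists y : E, forall C, admissible true C ->
    chain_norm 1 p (fun m => modulus (z m - coords y m)) C <= e) ->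
  exists x : E, coords x = z.
Proof.
move=> zP.
have zfin : z \in finite_enorm (baernstein_enorm k p_gt1).
  have [y yP] := zP 1 ltr01; rewrite unfold_in.
  rewrite (_ : z = (z - coords y) + coords y); last by rewrite subrK.
  apply: le_lt_trans (enormD _ _ _) _; rewrite lte_add_pinfty//.
    by apply: le_lt_trans (baernstein_norm_le yP) (ltry _).
  by have := coordsP y; rewrite unfold_in.
by exists (FiniteNormSpace zfin).
Qed.

Lemma baernstein_chain_space : chain_space 1 p true E.
Proof.
have cD (x y : E) m : coords (x + y) m = coords x m + coords y m by [].
have cZ a (x : E) m : coords (a *: x) m = a * coords x m.
  have cooZ : coords (a *: x) = a *: coords x by [].
  by rewrite cooZ.
have nE (x : E) : `|x| = of_real k (normE x) by [].
exact: (ChainSpace cD cZ nE baernstein_chain_norm_le baernstein_norm_ler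
  baernstein_small_tail baernstein_complete).
Qed.

End BaernsteinSpace.

Theorem theorem1p1 (R : realType) (k : scalar_kind)
    (E : normedModType (scalars R k))
    (hE : (exists (p : R) (p_gt1 : 1 < p), E = baernstein_space k p_gt1) \/
          (exists (p : R) (p_ge1 : 1 <= p), E = schreier_space k p_ge1))
    (T U : {linear E -> E})
    (hT : bounded_operator T) (hU : bounded_operator U)
    (sT : strictly_singular T) (sU : strictly_singular U) :
  compact_operator (T \o U).
Proof.
case: hE => [[p [p_gt1 EE]]|[p [p_ge1 EE]]]; subst E.
  exact: (composite_compact (lexx 1) (ltW p_gt1)
    (baernstein_chain_space k p_gt1) hT hU sT sU).
exact: (composite_compact p_ge1 (lexx 1)
  (schreier_chain_space k p_ge1) hT hU sT sU).
Qed.
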